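(* Let $k$ be a positive integer. Then $$\sum_{j=1}^{k}\left(\genfrac\{\}{0pt}{}{k}{j}\cdot\#\{\text{involutions in }\mathfrak{S}_j\}\right)=\sum_{t=1}^{k}\left(\genfrac\{\}{0pt}{}{k}{t}2^{k-t}\right),$$ where $\genfrac\{\}{0pt}{}{k}{j}$ is the Stirling number of the second kind (the number of set partitions of $[k]$ into $j$ blocks) and $\mathfrak{S}_j$ is the symmetric group on $[j]$. Consequently, the sequence $(a_k)_{k=0}^\infty$, where $a_0=1$ and $a_k$ is the number of limiting vacillating tableaux of length $2k$ for $k\ge1$, is exactly the OEIS sequence A004211, i.e. the sequence $(c_k)_{k=0}^\infty$ with $c_0=1$ and $c_k=\sum_{t=1}^{k}2^{k-t}\genfrac\{\}{0pt}{}{k}{t}$ for $k\ge1$.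
   Context: Notation: $[n]=\{1,2,\dots,n\}$. An involution in $\mathfrak{S}_j$ is a permutation that is a product of disjoint $1$-cycles and $2$-cycles (i.e. $\sigma^2=1$, the identity included). Integer partitions are identified with their Young diagrams (English notation, rows left-justified, row $j$ having $\lambda_j$ boxes, rows numbered from the top). A partial tableau is a filling of the boxes of an integer partition (its shape) with distinct positive integers increasing along rows (left to right) and down columns. RSK row insertion $x\xrightarrow{RSK}T$, for a partial tableau $T$ and a positive integer $x$ not in $T$: let $R$ be the first row of $T$. While $x$ is less than some element of $R$: let $y$ be the smallest element of $R$ greater than $x$; replace $y$ in $R$ by $x$; set $x:=y$ and let $R$ be the next row. When $x$ is not less than any element of $R$, place $x$ at the end of $R$ (which is possibly empty). The result is a partial tableau. Jeu de taquin deletion $x\xleftarrow{jdt}T$, for a partial tableau $T$ and an entry $x$ of $T$: let $c$ be the box containing $x$, at position $(i,j)$ (row $i$, column $j$). While the position $(i,j)$ of $x$ is not a corner (a box that is both at the end of its row and at the end of its column), exchange $x$ with the smaller of the entries at positions $(i+1,j)$ and $(i,j+1)$ (if only one of these exists, exchange with that one), and update $(i,j)$ to be the new position of $x$. When $x$ is in a corner, delete that box. The result is a partial tableau. The vacillating tableau $P^k_m(\boldsymbol{i})$, for $\boldsymbol{i}=(i_1,\dots,i_k)\in[m]^k$: let $T^{(0)}$ be the tableau of one row of shape $(m)$ with entries $1,2,\dots,m$. For integers $j=0,1,\dots,k-1$ put $T^{(j+\frac12)}=\left(i_{j+1}\xleftarrow{jdt}T^{(j)}\right)$ and $T^{(j+1)}=\left(i_{j+1}\xrightarrow{RSK}T^{(j+\frac12)}\right)$.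 Let $\lambda^{(j)}$ be the shape of $T^{(j)}$ for every index $j\in\{0,\frac12,1,1\frac12,\dots,k\}$. Then $P^k_m(\boldsymbol{i})=(\lambda^{(0)},\lambda^{(\frac12)},\lambda^{(1)},\dots,\lambda^{(k-\frac12)},\lambda^{(k)})$. Simplified version: for an integer partition $\lambda=(\lambda_1,\lambda_2,\dots,\lambda_t)$, let $\lambda^*=(\lambda_2,\dots,\lambda_t)$ be obtained by removing the first part. For a sequence $P=(\lambda^{(j)}: j=0,\frac12,1,\dots,k)$ of partitions, $P^*=((\lambda^{(j)})^*: j=0,\frac12,1,\dots,k)$. Limiting vacillating tableau: for $\boldsymbol{i}\in[n]^k$, the sequence $(P^k_m(\boldsymbol{i}))^*$ is the same for all $m>n+2k$; this common value is denoted $P^*(\boldsymbol{i})$ and called the limiting vacillating tableau of $\boldsymbol{i}$. The limiting vacillating tableaux of length $2k$ are the distinct sequences $P^*(\boldsymbol{i})$ as $\boldsymbol{i}$ ranges over all sequences of $k$ positive integers. *)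

(* Defs.v *)
From mathcomp Require Import all_boot all_fingroup finmap.
From mathcomp Require Import mathcomp_extra boolp classical_sets cardinality.

Set Implicit Arguments.
Unset Strict Implicit.
Unset Printing Implicit Defensive.

Definition stirling2 (k j : nat) : nat :=
  #|[set P : {set {set 'I_k}} | finset.partition P [set: 'I_k]%SET & #|P| == j]%SET|.

Definition involutions (j : nat) : nat :=
  #|[set s : 'S_j | (s ^+ 2 == 1)%g]%SET|.

(** A partial tableau is the sequence of its rows from the top, without empty
    rows; a partition is the sequence of its (nonzero) parts. Boxes are indexed
    from 0. The operations below are only meant for fillings with positive
    integers that increase along rows and down columns. *)
Definition tableau := seq (seq nat).
Definition partition_shape := seq nat.

Definition has_box (T : tableau) (i j : nat) : bool := j < size (nth [::] T i).

Definition entry (T : tableau) (i j : nat) : nat := nth 0 (nth [::] T i) j.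

Definition set_entry (T : tableau) (i j x : nat) : tableau :=
  set_nth [::] T i (set_nth 0 (nth [::] T i) j x).

(** The least element of a nonempty sequence. *)
Definition seq_min (s : seq nat) : nat := foldr minn (head 0 s) s.

Fixpoint rsk_insert (x : nat) (T : tableau) : tableau :=
  if T is R :: T' then
    if has (fun z => x < z) R then
      let y := seq_min [seq z <- R | x < z] in
      [seq (if z == y then x else z) | z <- R] :: rsk_insert y T'
    else rcons R x :: T'
  else [:: [:: x]].

(** Deletion of the last box of row [i], together with the row if it becomes
    empty. *)
Definition delete_corner (T : tableau) (i : nat) : tableau :=
  let R := nth [::] T i in
  [seq Q <- set_nth [::] T i (take (size R).-1 R) | Q != [::]].

Definition exchange (T : tableau) (i j i' j' : nat) : tableau :=
  set_entry (set_entry T i j (entry T i' j')) i' j' (entry T i j).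

(** [fuel] bounds the number of exchanges. *)
Fixpoint jdt_slide (fuel : nat) (T : tableau) (i j : nat) : tableau :=
  if fuel is fuel'.+1 then
    let down := jdt_slide fuel' (exchange T i j i.+1 j) i.+1 j in
    let right := jdt_slide fuel' (exchange T i j i j.+1) i j.+1 in
    match has_box T i.+1 j, has_box T i j.+1 with
    | true, true => if entry T i.+1 j < entry T i j.+1 then down else right
    | true, false => down
    | false, true => right
    | false, false => delete_corner T i
    end
  else T.

(** The number of boxes exceeds [i + j] for every box [(i, j)] of a tableau,
    and each exchange increases [i + j] by one, so the fuel never runs out
    before the corner is deleted. *)
Definition jdt_delete (x : nat) (T : tableau) : tableau :=
  let i := find (fun R => x \in R) T in
  jdt_slide (sumn (map size T)) T i (index x (nth [::] T i)).

Definition tableau_shape (T : tableau) : partition_shape := map size T.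

(** The shapes of T^(0), T^(1/2), T^(1), ..., T^(k), for T^(0) = [T] and
    k = [size s]. *)
Fixpoint shapes_from (T : tableau) (s : seq nat) : seq partition_shape :=
  tableau_shape T ::
  (if s is x :: s' then
     let T' := jdt_delete x T in
     tableau_shape T' :: shapes_from (rsk_insert x T') s'
   else [::]).

Definition vacillating_tableau (m : nat) (s : seq nat) : seq partition_shape :=
  shapes_from [:: iota 1 m] s.

(** Removal of the first part from every partition of the sequence. *)
Definition simplified (P : seq partition_shape) : seq partition_shape :=
  map behead P.

(** [P] is the common value of the simplified vacillating tableaux of [s]
    for all m > n + 2 k, where [n] is any bound on the entries of [s] and
    k = [size s]. *)
Definition is_limiting_vt (s : seq nat) (P : seq partition_shape) : Prop :=
  forall n m : nat, all (fun x => x <= n) s -> n + 2 * size s < m ->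
    simplified (vacillating_tableau m s) = P.

Definition limiting_vts (k : nat) : set (seq partition_shape) :=
  [set P | exists s : seq nat,
     [/\ size s = k, all (fun x => 0 < x) s & is_limiting_vt s P]]%classic.

(** [fset_set A] is the finite set with the elements of [A], and is empty when
    [A] is infinite. *)
Definition limiting_vt_count (k : nat) : nat :=
  if k is 0 then 1 else #|` fset_set (limiting_vts k)|%fset.

Definition A004211 (k : nat) : nat :=
  if k is 0 then 1
  else \sum_(1 <= t < k.+1) 2 ^ (k - t) * stirling2 k t.

(* Main.v *)
Require Import Defs.
From mathcomp Require Import all_boot all_fingroup finmap zify.

(** Three sequences are shown to satisfy the recurrence
    X_0 = 1, X_(k+1) = sum_(h <= k) C(k, h) 2^(k-h) X_h  ([doubling_recurrence]),
which determines them: the sum of S(k, j) times the number of involutions of j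
points, the sum of S(k, t) 2^(k-t), and the number of limiting vacillating
tableaux of length 2k.

For the second sum the recurrence follows from
S(k+1, j+1) = sum_i C(k, i) S(i, j). The other two are instances of one
argument ([heisenberg_doubling]). Let U and D act on functions with
UD = DU + 1, and let V_k be linear functionals with V_0 D = 0 and
V_(k+1) = V_k (U + DU). Then V_k (1 + D) = sum_i C(k, i) V_i. If moreover
Ue = e + De, applying this relation twice gives
V_(k+1) e = sum_i C(k, i) V_i (Ue) = sum_i C(k, i) sum_h C(i, h) V_h e,
and the binomial transform applied twice is the doubling sum
([sum_bin_bin]). For involutions, (Uf)(j) = f(j+1), (Df)(j) = j f(j-1),
V_k f = sum_j S(k, j) f(j), and Ue = e + De is the usual recurrence of the
involution numbers. For tableaux, U and D sum over the partitions with one box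
more or one box less, V_k f sums f over the ends of the walks of k rounds that
start at the empty partition and, in each round, stay or remove a box and then
add a box; here e = 1, because a partition has one more addable box than
removable boxes.

It remains to see that the limiting vacillating tableaux are exactly these
walks. A tableau is encoded by the word that lists the rows of its entries in
increasing order of the entries; the words obtained are the ballot words. Both
operations commute with the addition of a new largest entry, up to a change of
the row of that entry which is determined by the shape and by the row of the box
that has been added or removed so far ([rsk_push], [jdt_push]). They therefore act on words
as scans from left to right ([insert_word], [delete_word]). The first row of
the initial tableau is so long that the inserted integer is never the largest,
hence each insertion bumps and the new box lies below the first row: every
limiting vacillating tableau is a walk ([word_walk]). Conversely both scans can
be run backwards from any prescribed final box ([insert_word_inv],
[delete_word_inv]), so a walk can be read from its end to produce a sequence of
integers between 1 and 2k+1 ([walk_word]); appending zeros to the initial word,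
that is, enlarging m, changes nothing but the length of the first row
([simplified_rcons0]). *)

Set Implicit Arguments.
Unset Strict Implicit.
Unset Printing Implicit Defensive.

(** * The doubling recurrence *)

(** Pascal's rule: one step of an induction on [k] becomes a shift of [f]. *)
Lemma sum_bin_succ k (f : nat -> nat) :
  \sum_(i < k.+2) 'C(k.+1, i) * f i
  = \sum_(i < k.+1) 'C(k, i) * (f i + f i.+1).
Proof.
rewrite big_ord_recl bin0.
under eq_bigr => i _ do rewrite lift0 binS mulnDl.
rewrite big_split /= addnA.
under [RHS]eq_bigr => i _ do rewrite mulnDr.
rewrite [RHS]big_split /=; congr (_ + _).
rewrite big_ord_recr /= bin_small // mul0n addn0 [RHS]big_ord_recl bin0.
by congr (_ + _); apply: eq_bigr => i _; rewrite lift0.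
Qed.

(** The binomial transform [B] satisfies [B t k.+1 = B t k + B (t \o S) k]; applied
twice it satisfies the same relation with a factor [2], as does the right-hand side. *)
Lemma sum_bin_bin k (t : nat -> nat) :
  \sum_(i < k.+1) 'C(k, i) * \sum_(h < i.+1) 'C(i, h) * t h
  = \sum_(h < k.+1) 'C(k, h) * (2 ^ (k - h) * t h).
Proof.
elim: k t => [|k IH] t; first by rewrite !big_ord1.
rewrite (sum_bin_succ _ (fun i => \sum_(h < i.+1) 'C(i, h) * t h)).
rewrite [RHS](sum_bin_succ _ (fun h => 2 ^ (k.+1 - h) * t h)).
under eq_bigr => i _ do rewrite sum_bin_succ -big_split /=.
transitivity (2 * (\sum_(h < k.+1) 'C(k, h) * (2 ^ (k - h) * t h))
              + \sum_(h < k.+1) 'C(k, h) * (2 ^ (k - h) * t h.+1)).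
  rewrite -(IH t) -(IH (fun h => t h.+1)) big_distrr -big_split /=;
    apply: eq_bigr => i _.
  rewrite mulnCA -mulnDr; congr (_ * _); rewrite big_distrr -big_split /=.
  by apply: eq_bigr => h _; lia.
rewrite big_distrr -big_split /=; apply: eq_bigr => h _.
by rewrite subSS subSn -?[h <= k]ltnS // expnS; lia.
Qed.

Definition doubling_recurrence (x : nat -> nat) :=
  x 0 = 1 /\
  forall k, x k.+1 = \sum_(h < k.+1) 'C(k, h) * (2 ^ (k - h) * x h).

Lemma doubling_recurrence_uniq x y :
  doubling_recurrence x -> doubling_recurrence y -> x =1 y.
Proof.
move=> [x0 xS] [y0 yS]; elim/ltn_ind=> -[|k] IH; first by rewrite x0 y0.
by rewrite xS yS; apply: eq_bigr => h _; rewrite IH.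
Qed.

Section Heisenberg.

(** The functions matter only on [P]: on arbitrary sequences, unlike on partitions, the
commutation relation of the box operators fails. *)
Variables (X : Type) (P : X -> Prop) (U D : (X -> nat) -> X -> nat).
Variable V : nat -> (X -> nat) -> nat.

Hypothesis UDE : forall f l, P l -> U (D f) l = f l + D (U f) l.
Hypothesis V_ext : forall k f g, (forall l, P l -> f l = g l) -> V k f = V k g.
Hypothesis V_add : forall k f g, V k (fun l => f l + g l) = V k f + V k g.
Hypothesis V0D : forall f, V 0 (D f) = 0.
Hypothesis VS : forall k f, V k.+1 f = V k (U f) + V k (D (U f)).

(** In the induction step, [V k.+1 (D f)] is a combination of values at
[U (D f) = f + D (U f)]; the terms at [D (U f)] complete [V i (U f)] to [V i.+1 f],
and Pascal's rule applies. *)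
Lemma heisenberg_binomial k f :
  V k f + V k (D f) = \sum_(i < k.+1) 'C(k, i) * V i f.
Proof.
elim: k f => [|k IH] f; first by rewrite V0D big_ord1 bin0 mul1n addn0.
have {}IH g : V k.+1 g = \sum_(i < k.+1) 'C(k, i) * V i (U g) by rewrite VS IH.
rewrite (sum_bin_succ _ (V ^~ f)) !IH -big_split; apply: eq_bigr => i _ /=.
by rewrite (V_ext i (UDE f)) V_add VS; lia.
Qed.

Lemma heisenberg_doubling e :
  (forall l, P l -> U e l = e l + D e l) -> V 0 e = 1 ->
  doubling_recurrence (V ^~ e).
Proof.
move=> Ue V0e; split=> // k; rewrite VS heisenberg_binomial -(sum_bin_bin k (V ^~ e)).
by apply: eq_bigr => i _; rewrite (V_ext i Ue) V_add heisenberg_binomial.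
Qed.

End Heisenberg.

(** * Stirling numbers and involutions *)

(** The recursion is on the number of blocks: the elements outside the block of a
chosen point form a set of [i] elements, partitioned into one block fewer. *)
Fixpoint stirling (k j : nat) : nat :=
  match j, k with
  | 0, _ => k == 0
  | _, 0 => 0
  | j'.+1, k'.+1 => \sum_(i < k'.+1) 'C(k', i) * stirling i j'
  end.

Arguments stirling : simpl never.

Lemma stirlingSS k j :
  stirling k.+1 j.+1 = \sum_(i < k.+1) 'C(k, i) * stirling i j.
Proof. by []. Qed.

Lemma stirlingn0 k : stirling k 0 = (k == 0).
Proof. by []. Qed.

Lemma stirling0S j : stirling 0 j.+1 = 0.
Proof. by []. Qed.

Lemma stirling_small k j : k < j -> stirling k j = 0.
Proof.
elim: j k => [|j IH] [|k] // lt_kj; rewrite stirlingSS big1 // => i _.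
by rewrite IH ?muln0 //; have := ltn_ord i; lia.
Qed.

(** The triangular recurrence is what makes the sums over [stirling] follow the step
[V_(k+1) = V_k (U + D U)]. *)
Lemma stirling_recurrence k j :
  stirling k.+1 j.+1 = stirling k j + j.+1 * stirling k j.+1.
Proof.
elim: j k => [|j IHj] [|k].
- by rewrite stirlingSS big_ord1.
- rewrite stirlingSS (sum_bin_succ _ (stirling^~ 0)) stirlingSS mul1n add0n.
  by apply: eq_bigr => i _; congr (_ * _); exact: addn0.
- by rewrite stirlingSS big_ord1 mul1n muln0 addn0.
rewrite stirlingSS (sum_bin_succ _ (stirling^~ j.+1)).
rewrite (stirlingSS k j) (stirlingSS k j.+1) big_distrr -big_split;
  apply: eq_bigr => i _ /=.
by rewrite IHj; lia.
Qed.

Section CountPartitions.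
Variable T : finType.
Implicit Types (A B : {set T}) (P : {set {set T}}).

Definition partitions A j := [set P | partition P A & #|P| == j].

Lemma block_pblock P A x : partition P A -> x \in A -> 
  pblock P x \in P /\ x \in pblock P x.
Proof.
move=> partP Ax; have [/eqP covP _ _] := and3P partP.
by rewrite -covP in Ax; rewrite pblock_mem ?mem_pblock.
Qed.

(** Removing the block of [x] leaves a partition of the complement [B] of that block,
and any partition of [B] is completed by the block [A :\: B]. *)
Lemma card_partitions_block A x B j : x \in A -> B \subset A :\ x ->
  #|[set P in partitions A j.+1 | pblock P x == A :\: B]| = #|partitions B j|.
Proof.
move=> Ax sBA; have sBA' : B \subset A by apply: subset_trans sBA (subsetDl _ _).
have xB : x \notin B by apply/negP => /(subsetP sBA); rewrite !inE eqxx.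
have xAB : x \in A :\: B by rewrite !inE xB.
have AB0 : A :\: B != set0 by apply/set0Pn; exists x.
have AAB : A :\: (A :\: B) = B by rewrite setDDr setDv set0U; apply/setIidPr.
have AE : A :\: B :|: B = A by rewrite setUC -{1}(setIidPr sBA') setID.
have nAB P : partition P B -> A :\: B \notin P.
  move=> partP; apply/negP => /(partitionS partP) /subsetP/(_ x xAB).
  by rewrite (negPf xB).
rewrite -(card_in_imset (f := fun P => A :\: B |: P) (D := partitions B j)).
  apply: eq_card => P; rewrite !inE; apply/idP/imsetP.
    move=> /andP[/andP[partP /eqP cardP] /eqP PxE].
    have [PxP _] := block_pblock partP Ax; rewrite PxE in PxP.
    exists (P :\ (A :\: B)); last by rewrite setD1K.
    have := cardsD1 (A :\: B) P; rewrite PxP cardP add1n => -[cardP'].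
    rewrite inE -cardP' eqxx andbT.
    by have := partitionD1 partP PxP; rewrite AAB.
  move=> [Q]; rewrite inE => /andP[partQ /eqP cardQ] ->.
  have partU : partition (A :\: B |: Q) A.
    have := partitionU1 partQ AB0; rewrite AE; apply.
    by rewrite disjoints_subset setDE subsetIr.
  rewrite partU cardsU1 nAB // cardQ eqxx /=.
  have [_ tiU _] := and3P partU.
  by rewrite (def_pblock tiU _ xAB) // setU11.
move=> P Q; rewrite !inE => /andP[pP _] /andP[pQ _] /(congr1 (fun S => S :\ (A :\: B))).
by rewrite !setU1K ?nAB.
Qed.

Lemma card_subsets_sum A (f : nat -> nat) :
  \sum_(B : {set T} | B \subset A) f #|B| = \sum_(i < #|A|.+1) 'C(#|A|, i) * f i.
Proof.
pose sz (B : {set T}) : 'I_#|A|.+1 := inord #|B|.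
have szE B : B \subset A -> sz B = #|B| :> nat.
  by move=> /subset_leq_card sBA; rewrite inordK.
rewrite (partition_big sz predT) //=; apply: eq_bigr => i _.
rewrite (eq_bigr (fun=> f i)) => [|B /andP[sBA /eqP <-]]; last by rewrite szE.
rewrite sum_nat_const -cards_draws; congr (_ * _); apply: eq_card => B.
rewrite !inE unfold_in; case sBA: (B \subset A) => //=.
by rewrite -val_eqE /= szE.
Qed.

Lemma card_partitions A j : #|partitions A j| = stirling #|A| j.
Proof.
elim: j A => [|j IH] A.
  have [->|] := eqVneq A set0.
    rewrite cards0; apply/eqP/cards1P; exists set0; apply/setP => P.
    by rewrite !inE partition_set0 cards_eq0 andbb.
  move=> A0; rewrite stirlingn0 cards_eq0 (negPf A0); apply/eqP; rewrite cards_eq0.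
  apply/eqP/setP => P; rewrite !inE cards_eq0; apply/negP => /andP[/cover_partition].
  by move=> + /eqP P0; rewrite P0 /cover big_set0 => A0'; rewrite -A0' eqxx in A0.
have [->|/set0Pn[x Ax]] := eqVneq A set0.
  rewrite cards0 stirling0S; apply/eqP; rewrite cards_eq0.
  apply/eqP/setP => P; rewrite !inE partition_set0; apply/negP => /andP[/eqP ->].
  by rewrite cards0.
rewrite (cardsD1 x A) Ax stirlingSS -(card_subsets_sum _ (stirling^~ j)).
rewrite -sum1_card (partition_big (fun P => A :\:
  pblock P x) (fun B => B \subset A :\ x)).
  apply: eq_bigr => B sB; rewrite -IH -(card_partitions_block _ Ax sB) -sum1_card.
  apply: eq_bigl => P; rewrite !inE; apply: andb_id2l => /andP[partP _].
  have [PxP xPx] := block_pblock partP Ax.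
  have sPx := partitionS partP PxP.
  have sBA : B \subset A by apply: subset_trans sB (subsetDl _ _).
  by apply/eqP/eqP => [<-|->]; rewrite setDDr setDv set0U; [apply/esym|];
    apply/setIidPr.
move=> P; rewrite inE => /andP[partP _].
by have [_ xPx] := block_pblock partP Ax; rewrite setDS // sub1set.
Qed.

End CountPartitions.

Lemma stirling2E k j : stirling2 k j = stirling k j.
Proof. by rewrite /stirling2 -[k in RHS]card_ord -cardsT -card_partitions. Qed.

Fixpoint involution_number (n : nat) : nat :=
  match n with
  | 0 => 1
  | m.+1 => (if m is p.+1 then m * involution_number p else 0) + involution_number m
  end.

Lemma involution_numberS n :
  involution_number n.+1 = involution_number n + n * involution_number n.-1.
Proof. by case: n => //= n; rewrite addnC. Qed.

Section CountInvolutions.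
Variable T : finType.
Implicit Types (A : {set T}) (s : {perm T}).

Definition involutions_on A := [set s | perm_on A s & (s ^+ 2 == 1)%g].

Lemma involP s : reflect (forall z, s (s z) = z) (s ^+ 2 == 1)%g.
Proof.
apply: (iffP eqP) => [s2 z|ss];
  first by rewrite -permM -[(s * s)%g]/(s ^+ 2)%g s2 perm1.
by apply/permP => z; rewrite expgS expg1 permM ss perm1.
Qed.

Lemma perm_onD1 A s x : perm_on (A :\ x) s = perm_on A s && (s x == x).
Proof.
apply/idP/andP => [sA|[sA /eqP sx]].
  split; last by apply/eqP/(out_perm sA); rewrite !inE eqxx.
  by apply: subset_trans sA (subsetDl _ _).
apply/subsetP => z; rewrite !inE => szz; rewrite (subsetP sA) ?inE // andbT.
by apply: contraNneq szz => ->; rewrite sx.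
Qed.

Lemma tperm_mul_invol A s x y : x \in A -> y \in A :\ x ->
  s \in involutions_on (A :\ x :\ y) ->
  (tperm x y * s)%g \in involutions_on A /\ (tperm x y * s)%g x = y.
Proof.
move=> Ax /setD1P[yx Ay]; rewrite !inE !perm_onD1.
move=> /andP[/andP[/andP[sA /eqP sx] /eqP sy] /involP ss].
split; last by rewrite permM tpermL sy.
apply/andP; split.
  apply/subsetP => z; rewrite inE permM; case: tpermP => [->|->|_ _ szz] //.
  by apply: (subsetP sA); rewrite inE.
apply/involP => z; rewrite !permM; case: (tpermP x y z) => [->|->|/eqP zx /eqP zy].
- by rewrite sy tpermR sx.
- by rewrite sx tpermL sy.
by rewrite tpermD ?ss // eq_sym -1?sx -1?sy (inj_eq perm_inj).
Qed.

Lemma card_involutions_on_fiber A x y : x \in A -> y \in A :\ x ->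
  #|[set s in involutions_on A | s x == y]| = #|involutions_on (A :\ x :\ y)|.
Proof.
move=> Ax AxDy; have /setD1P[yx Ay] := AxDy.
rewrite -[RHS](card_imset _ (@mulgI _ (tperm x y))); apply: eq_card => s.
apply/idP/imsetP => [|[s' s'I ->]]; last first.
  by rewrite inE; have [-> ->] := tperm_mul_invol Ax AxDy s'I; rewrite eqxx.
rewrite !inE => /andP[/andP[sA /involP ss] /eqP sx].
have sy : s y = x by rewrite -sx ss.
exists (tperm x y * s)%g; last by rewrite mulgA tperm2 mul1g.
rewrite inE !perm_onD1 !permM tpermL tpermR sx sy !eqxx !andbT; apply/andP; split.
  apply/subsetP => z; rewrite inE permM; case: tpermP => [->|->|_ _ szz] //.
  by apply: (subsetP sA); rewrite inE.
apply/involP => z; rewrite !permM; case: (tpermP x y z) => [->|->|/eqP zx /eqP zy].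
- by rewrite sy tpermL sy.
- by rewrite sx tpermR sx.
by rewrite tpermD ?ss //; [rewrite -sy|rewrite -sx]; rewrite (inj_eq perm_inj) eq_sym.
Qed.

(** An involution that fixes [x] lives on [A :\ x]; one that exchanges [x] and [y]
is the transposition of [x] and [y] times an involution of the other points. *)
Lemma card_involutions_on A : #|involutions_on A| = involution_number #|A|.
Proof.
have [n] := ubnP #|A|; elim: n => // n IH in A *; rewrite ltnS => leAn.
have [->|/set0Pn[x Ax]] := eqVneq A set0.
  rewrite cards0; apply/eqP/cards1P; exists 1%g; apply/setP => s; rewrite !inE.
  apply/andP/eqP => [[s0 _]|->]; last by rewrite perm_on1 expg1n eqxx.
  by apply/permP => z; rewrite perm1 (out_perm s0) ?inE.
have cA := cardsD1 x A; rewrite Ax add1n in cA.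
have ltAn : #|A :\ x| < n by rewrite -cA.
rewrite cA involution_numberS -(IH _ ltAn) -sum1_card.
rewrite (partition_big (fun s : {perm T} => s x) [in A]) /=; last first.
  by move=> s; rewrite inE => /andP[sA _]; rewrite perm_closed.
rewrite (bigD1 x) //=; congr (_ + _).
  rewrite -[RHS]sum1_card; apply: eq_bigl => s.
  by rewrite !inE perm_onD1 -!andbA; congr (_ && _); rewrite andbC.
rewrite -sum_nat_const; rewrite [LHS](eq_bigl [in A :\ x]) => [|y]; last first.
  by rewrite !inE andbC.
apply: eq_bigr => y Ay; have cAx := cardsD1 y (A :\ x); rewrite Ay add1n in cAx.
rewrite {1}cAx /= -IH; last by rewrite cAx in ltAn; apply: ltnW.
by rewrite -(card_involutions_on_fiber Ax Ay) -sum1_card; apply: eq_bigl => s;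
  rewrite !inE.
Qed.

End CountInvolutions.

Lemma involutionsE j : involutions j = involution_number j.
Proof.
rewrite -[j in RHS]card_ord -cardsT -card_involutions_on; apply: eq_card => s.
by rewrite !inE; apply/esym/andb_idl => _; apply/subsetP => z; rewrite inE.
Qed.

Lemma sum_stirling_le n k (f : nat -> nat) : k <= n ->
  \sum_(j < n.+1) stirling k j * f j = \sum_(j < k.+1) stirling k j * f j.
Proof.
move=> le_kn; rewrite [RHS](big_ord_widen n.+1 (fun j =>
  stirling k j * f j)) // [RHS]big_mkcond.
by apply: eq_bigr => j _; case: ltnP => // lt_kj; rewrite stirling_small.
Qed.

Lemma stirling_involution_doubling :
  doubling_recurrence (fun k => \sum_(j < k.+1) stirling k j * involution_number j).
Proof.
pose U (f : nat -> nat) j := f j.+1; pose D (f : nat -> nat) j := j * f j.-1.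
apply: (@heisenberg_doubling nat (fun=> True) U D
          (fun k f => \sum_(j < k.+1) stirling k j * f j)) => //.
- by move=> f [|l] _; rewrite /U /D /=; lia.
- by move=> k f g fg; apply: eq_bigr => j _; rewrite fg.
- by move=> k f g; rewrite -big_split; apply: eq_bigr => j _ /=; rewrite mulnDr.
- by move=> f; rewrite big_ord1.
- move=> k f; rewrite big_ord_recl stirlingn0 add0n /U /D.
  transitivity (\sum_(j < k.+1) (stirling k j * f j.+1 + j.+1 * (stirling k j.+1 * f j.+1))).
    by apply: eq_bigr => j _; rewrite lift0 stirling_recurrence; lia.
  rewrite big_split; congr (_ + _).
  rewrite big_ord_recr [RHS]big_ord_recl (@stirling_small k k.+1) // !muln0 add0n.
  by rewrite [LHS]addn0; apply: eq_bigr => j _; rewrite lift0 mulnCA.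
- by move=> j _; rewrite /U /D involution_numberS.
- by rewrite big_ord1.
Qed.

Lemma stirling_pow2_doubling :
  doubling_recurrence (fun k => \sum_(t < k.+1) stirling k t * 2 ^ (k - t)).
Proof.
split=> [|k]; first by rewrite big_ord1.
rewrite big_ord_recl stirlingn0 add0n.
under eq_bigr => t _ do rewrite lift0 stirlingSS subSS big_distrl /=.
rewrite exchange_big /=; apply: eq_bigr => i _.
have le_ik : i <= k by rewrite -ltnS.
under eq_bigr => t _ do rewrite -mulnA.
rewrite -big_distrr (sum_stirling_le (fun t => 2 ^ (k - t)) le_ik); congr (_ * _).
rewrite big_distrr; apply: eq_bigr => t _ /=.
have le_ti : t <= i by rewrite -ltnS.
rewrite mulnCA -expnD; congr (_ * 2 ^ _); lia.
Qed.

Lemma sum_stirling2_from1 k (f : nat -> nat) : 0 < k ->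
  \sum_(1 <= j < k.+1) stirling2 k j * f j = \sum_(j < k.+1) stirling k j * f j.
Proof.
case: k => // k _; rewrite [RHS]big_ord_recl stirlingn0 add0n big_add1 big_mkord.
by apply: eq_bigr => j _; rewrite stirling2E.
Qed.

(** * Walks in Young's lattice *)

(** Deleting default values does not change the entries of a sequence in which the
default values form a suffix: this covers both zero parts and empty rows. *)
Lemma nth_filter_neq (T : eqType) (x0 : T) (s : seq T) i :
  (forall j, nth x0 s j = x0 -> nth x0 s j.+1 = x0) ->
  nth x0 [seq y <- s | y != x0] i = nth x0 s i.
Proof.
elim: s i => [|y s IH] //= i s0.
have [y0|_] := eqVneq y x0; last by case: i => //= i; apply: IH => j; apply: (s0 j.+1).
have {}s0 j : nth x0 (y :: s) j = x0 by elim: j => // j /s0.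
rewrite s0 IH => [|j _]; [exact: (s0 i.+1)|exact: (s0 j.+2)].
Qed.

Lemma eq_from_nth_notin (T : eqType) (x0 : T) (s t : seq T) :
  x0 \notin s -> x0 \notin t -> (forall i, nth x0 s i = nth x0 t i) -> s = t.
Proof.
move=> s0 t0 eq_st; apply: (@eq_from_nth _ x0) => //.
have size_le (u v : seq T) : x0 \notin v ->
    (forall i, nth x0 u i = nth x0 v i) -> size v <= size u.
  move=> v0 eq_uv; rewrite leqNgt; apply: contra v0 => lt_uv.
  by rewrite -(nth_default x0 (leqnn (size u))) eq_uv mem_nth.
by apply/eqP; rewrite eqn_leq !size_le.
Qed.

Definition is_part (l : seq nat) :=
  0 \notin l /\ forall i, nth 0 l i.+1 <= nth 0 l i.

Definition addable (l : seq nat) i := (i == 0) || (nth 0 l i < nth 0 l i.-1).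
Definition removable (l : seq nat) i := nth 0 l i.+1 < nth 0 l i.

(** Filtering drops the part that vanishes when a row of length one is removed. *)
Definition decr_nth (l : seq nat) i :=
  [seq y <- set_nth 0 l i (nth 0 l i).-1 | y != 0].

Definition ups l := [seq incr_nth l i | i <- index_iota 0 (size l).+1 & addable l i].
Definition downs l := [seq decr_nth l i | i <- index_iota 0 (size l) & removable l i].

Lemma part_eq l m : is_part l -> is_part m ->
  (forall i, nth 0 l i = nth 0 m i) -> l = m.
Proof. by move=> [l0 _] [m0 _]; apply: eq_from_nth_notin. Qed.

Lemma addable_size l i : addable l i -> i <= size l.
Proof.
rewrite /addable; case: i => //= i; rewrite ltnNge; apply: contraNltn => ?.
by rewrite nth_default.
Qed.

Lemma removable_size l i : removable l i -> i < size l.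
Proof. by rewrite /removable ltnNge; apply: contraNltn => ?; rewrite nth_default. Qed.

Lemma mem_incr_nth0 l i : 0 \notin l -> i <= size l -> 0 \notin incr_nth l i.
Proof.
elim: l i => [|n l IH] [|i] //=; rewrite !inE !negb_or => /andP[n0 l0] leil.
  by rewrite l0.
by rewrite n0 IH.
Qed.

Lemma is_part_incr l i : is_part l -> addable l i -> is_part (incr_nth l i).
Proof.
move=> [l0 lS] Ai; split; first by rewrite mem_incr_nth0 ?addable_size.
move=> j; rewrite !nth_incr_nth; have := lS j; move: Ai; rewrite /addable.
by case: (eqVneq i j.+1) => [->|_] /=; lia.
Qed.

Lemma nth_decr_nth l i j : is_part l -> removable l i ->
  nth 0 (decr_nth l i) j = nth 0 l j - (j == i).
Proof.
move=> [_ lS]; rewrite /removable => Ri; rewrite nth_filter_neq => [|r].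
  by rewrite nth_set_nth /=; case: eqP => [->|_]; lia.
rewrite !nth_set_nth /=; have := lS r; case: (eqVneq r i) => [->|_];
  first by rewrite gtn_eqF; lia.
by case: (eqVneq r.+1 i) => [<-|_]; lia.
Qed.

Lemma is_part_decr l i : is_part l -> removable l i -> is_part (decr_nth l i).
Proof.
move=> lP Ri; split; first by rewrite mem_filter eqxx.
move=> j; rewrite !nth_decr_nth //; have := lP.2 j; move: Ri; rewrite /removable.
by case: (eqVneq j i) => [->|_]; case: eqP => //; lia.
Qed.

Lemma size_decr_nth l i : removable l i -> size (decr_nth l i) <= size l.
Proof.
move=> /removable_size lt_il; rewrite size_filter; apply: leq_trans (count_size _ _) _.
by rewrite size_set_nth geq_max lt_il leqnn.
Qed.

Lemma decr_incr l i : is_part l -> addable l i ->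
  removable (incr_nth l i) i /\ decr_nth (incr_nth l i) i = l.
Proof.
move=> lP Ai; have iP := is_part_incr lP Ai.
have Ri : removable (incr_nth l i) i.
  by rewrite /removable !nth_incr_nth eqxx; have := lP.2 i; case: eqP => //; lia.
split=> //; apply: part_eq => //; first exact: is_part_decr.
by move=> j; rewrite nth_decr_nth // nth_incr_nth [i == j]eq_sym; lia.
Qed.

Lemma incr_decr l i : is_part l -> removable l i ->
  addable (decr_nth l i) i /\ incr_nth (decr_nth l i) i = l.
Proof.
move=> lP Ri; have dP := is_part_decr lP Ri.
have Ai : addable (decr_nth l i) i.
  rewrite /addable !nth_decr_nth // eqxx; move: Ri; rewrite /removable.
  by case: i dP => //= i _; have := lP.2 i; case: eqP; lia.
split=> //; apply: part_eq => //; first exact: is_part_incr.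
move=> j; rewrite nth_incr_nth nth_decr_nth // eq_sym; move: Ri; rewrite /removable.
by case: eqP => [->|_]; lia.
Qed.

(** Adding a box in row [i] and removing one in another row [j] can be done in either
order, neighbouring rows included; only [i = j] contributes to the commutator of
the two operators. *)
Lemma incr_decr_comm l i j : is_part l -> i != j ->
  addable l i && removable (incr_nth l i) j
    = removable l j && addable (decr_nth l j) i /\
  (addable l i && removable (incr_nth l i) j ->
   decr_nth (incr_nth l i) j = incr_nth (decr_nth l j) i).
Proof.
move=> lP ij.
have E : addable l i && removable (incr_nth l i) j
         = removable l j && addable (decr_nth l j) i.
  case Rj: (removable l j) => /=.
    rewrite /addable !nth_decr_nth // (negPf ij) /removable !nth_incr_nth (negPf ij).
    move: Rj; rewrite /removable; case: i ij => [|i] //= ij.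
    by case: (eqVneq i j) ij => [->|nij]; rewrite ?eqxx /= ?(negPf nij) /=; lia.
  apply/negbTE; rewrite negb_and; apply/orP; right; move: Rj.
  by rewrite /removable !nth_incr_nth (negPf ij); lia.
split=> // ARij; move: (ARij); rewrite E => /andP[Rj Ai'].
move: ARij => /andP[Ai Rj'].
apply: part_eq.
- by apply: is_part_decr => //; apply: is_part_incr.
- by apply: is_part_incr => //; apply: is_part_decr.
move=> r; rewrite nth_incr_nth !nth_decr_nth ?nth_incr_nth //; last exact: is_part_incr.
move: Rj; rewrite /removable; case: (eqVneq r j) => [->|_]; last by lia.
by case: eqP; lia.
Qed.

Definition up_sum (f : seq nat -> nat) l := \sum_(m <- ups l) f m.
Definition down_sum (f : seq nat -> nat) l := \sum_(m <- downs l) f m.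

Lemma up_sumE n f l : size l < n ->
  up_sum f l = \sum_(0 <= i < n | addable l i) f (incr_nth l i).
Proof.
move=> lt_ln; rewrite /up_sum big_map big_filter (big_nat_widen _ _ _ _ _ lt_ln).
by apply: eq_bigl => i; apply/andb_idr => /addable_size.
Qed.

Lemma down_sumE n f l : size l <= n ->
  down_sum f l = \sum_(0 <= i < n | removable l i) f (decr_nth l i).
Proof.
move=> lt_ln; rewrite /down_sum big_map big_filter (big_nat_widen _ _ _ _ _ lt_ln).
by apply: eq_bigl => i; apply/andb_idr => /removable_size.
Qed.

Lemma size_incr_nth_le l i : addable l i -> size (incr_nth l i) <= (size l).+1.
Proof. by move=> /addable_size; rewrite size_incr_nth; case: ltnP; lia. Qed.

(** A box can be added in the first row, and in row [i.+1] exactly when one can be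
removed from row [i]. *)
Lemma sum_addable l x :
  \sum_(0 <= i < (size l).+2 | addable l i) x
  = x + \sum_(0 <= i < (size l).+1 | removable l i) x.
Proof.
by rewrite big_mkcond big_nat_recl // [in RHS]big_mkcond.
Qed.

(** The terms with distinct rows cancel by [incr_decr_comm]; on the diagonal there is
one addable row more than there are removable rows. *)
Lemma up_down_sum f l : is_part l ->
  up_sum (down_sum f) l = f l + down_sum (up_sum f) l.
Proof.
move=> lP.
(* A common bound on all row indices, so that the sums can be exchanged. *)
pose n := (size l).+2.
have lt_ln : size l < n by [].
rewrite (up_sumE _ lt_ln) (down_sumE _ (ltnW lt_ln)).
under eq_bigr => i Ai do
  rewrite (@down_sumE n) ?(leq_trans (size_incr_nth_le Ai)) // big_mkcond.
under [in RHS]eq_bigr => j Rj do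
  rewrite (@up_sumE n) ?(leq_ltn_trans (size_decr_nth Rj)) // big_mkcond.
rewrite big_mkcond [in RHS]big_mkcond /=.
pose F i j := if addable l i && removable (incr_nth l i) j
              then f (decr_nth (incr_nth l i) j) else 0.
pose G i j := if removable l j && addable (decr_nth l j) i
              then f (incr_nth (decr_nth l j) i) else 0.
transitivity (\sum_(0 <= i < n) \sum_(0 <= j < n) F i j).
  by apply: eq_bigr => i _; rewrite /F; case: ifP => //= _; rewrite big1_eq.
transitivity (f l + \sum_(0 <= j < n) \sum_(0 <= i < n) G i j); last first.
  congr (_ + _); apply: eq_bigr => j _; rewrite /G.
  by case: ifP => //= _; rewrite big1_eq.
rewrite [in RHS]exchange_big /=.
have split_diag H : \sum_(0 <= i < n) \sum_(0 <= j < n) H i j =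
    \sum_(0 <= i < n) H i i + \sum_(0 <= i < n) \sum_(0 <= j < n | j != i) H i j :> nat.
  rewrite -big_split /= big_nat [in RHS]big_nat; apply: eq_bigr => i /andP[_ lt_in].
  by rewrite (bigD1_seq i) ?mem_index_iota ?iota_uniq.
rewrite !split_diag addnA; congr (_ + _); last first.
  apply: eq_bigr => i _; apply: eq_bigr => j ji; rewrite /F /G.
  by rewrite eq_sym in ji; have [<- E] := incr_decr_comm lP ji; case: ifP => // /E ->.
transitivity (\sum_(0 <= i < n | addable l i) f l).
  rewrite [RHS]big_mkcond; apply: eq_bigr => i _; rewrite /F.
  by case Ai: (addable l i) => //=; have [-> ->] := decr_incr lP Ai.
rewrite sum_addable; congr (_ + _); rewrite big_nat_recr //=.
rewrite /G [removable l (size l).+1 && _](_ : _ = false) ?addn0; last first.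
  by apply/negbTE/negP => /andP[/removable_size]; lia.
rewrite big_mkcond; apply: eq_bigr => i _.
by case Ri: (removable l i) => //=; have [-> ->] := incr_decr lP Ri.
Qed.

(** One round of a walk: stay or remove a box, then add a box. In the nested sum, the
outer operator is the earlier move. *)
Definition walk_step (f : seq nat -> nat) l := up_sum f l + down_sum (up_sum f) l.

(** The walks from [l] are listed with all intermediate partitions, in the format of
the simplified vacillating tableaux. *)
Fixpoint walks (k : nat) (l : seq nat) : seq (seq (seq nat)) :=
  if k is k'.+1 then
    [seq l :: h :: P | h <- l :: downs l, P <- [seq P | m <- ups h, P <- walks k' m]]
  else [:: [:: l]].

Lemma in_ups_part l m : is_part l -> m \in ups l -> is_part m.
Proof.
by move=> lP /mapP[i]; rewrite mem_filter => /andP[Ai _] ->; apply: is_part_incr.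
Qed.

Lemma in_downs_part l m : is_part l -> m \in downs l -> is_part m.
Proof.
by move=> lP /mapP[i]; rewrite mem_filter => /andP[Ai _] ->; apply: is_part_decr.
Qed.

Lemma eq_up_sum f g l : is_part l -> (forall m, is_part m -> f m = g m) ->
  up_sum f l = up_sum g l.
Proof.
by move=> lP fg; rewrite /up_sum; apply: eq_big_seq => m /(in_ups_part lP)/fg.
Qed.

Lemma eq_down_sum f g l : is_part l -> (forall m, is_part m -> f m = g m) ->
  down_sum f l = down_sum g l.
Proof.
by move=> lP fg; rewrite /down_sum; apply: eq_big_seq => m /(in_downs_part lP)/fg.
Qed.

Lemma size_walks k l : size (walks k l) = iter k walk_step (fun=> 1) l.
Proof.
elim: k l => // k IH l; rewrite /= size_cat size_map -/walks.
have E h : size [seq P | m <- ups h, P <- walks k m]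
           = up_sum (iter k walk_step (fun=> 1)) h.
  rewrite size_allpairs_dep sumnE big_map; apply: eq_bigr => m _; exact: IH.
rewrite E; congr (_ + _); rewrite size_allpairs_dep sumnE big_map.
by apply: eq_bigr => h _; rewrite E.
Qed.

Lemma size_walks_doubling : doubling_recurrence (fun k => size (walks k [::])).
Proof.
pose V k f := iter k walk_step f [::].
have partn : is_part [::] by split=> // i; rewrite !nth_nil.
have eq_iter k f g : (forall l, is_part l -> f l = g l) ->
    forall l, is_part l -> iter k walk_step f l = iter k walk_step g l.
  move=> fg; elim: k => //= k IH l lP; rewrite /walk_step (eq_up_sum lP IH).
  congr (_ + _); apply: eq_down_sum => // m mP; exact: eq_up_sum.
have upD f g l : up_sum (fun l => f l + g l) l = up_sum f l + up_sum g l.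
  by rewrite /up_sum big_split.
have downD f g l : down_sum (fun l => f l + g l) l = down_sum f l + down_sum g l.
  by rewrite /down_sum big_split.
have iterD k f g l : is_part l -> iter k walk_step (fun l => f l + g l) l
    = iter k walk_step f l + iter k walk_step g l.
  elim: k l => //= k IH l lP; rewrite /walk_step (eq_up_sum lP IH) upD.
  rewrite (@eq_down_sum _ (fun m => up_sum (iter k walk_step f) m
    + up_sum (iter k walk_step g) m) _ lP) ?downD => [|m mP]; first exact: addnACA.
  by rewrite (eq_up_sum mP IH) upD.
have := @heisenberg_doubling (seq nat) is_part up_sum down_sum V.
case/(_ _ _ _ _ _ (fun=> 1)) => //.
- by move=> f l; apply: up_down_sum.
- by move=> k f g fg; apply: eq_iter.
- by move=> k f g; apply: iterD.
- by move=> f; rewrite /V /= /down_sum big_nil.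
- by move=> k f; rewrite /V iterSr [walk_step f]/walk_step iterD.
- move=> l lP; rewrite (@up_sumE (size l).+2) // (@down_sumE (size l).+1) //.
  exact: sum_addable.
by move=> _ VS; split=> // k; rewrite size_walks [LHS]VS; apply: eq_bigr => h _;
  rewrite size_walks.
Qed.

Lemma walks_head k l P : P \in walks k l -> head [::] P = l.
Proof.
case: k => [|k]; first by rewrite inE => /eqP ->.
by move=> /(@allpairsPdep _ _ _ (fun h P => l :: h :: P))[h [Q [_ _ ->]]].
Qed.

Lemma uniq_ups l : uniq (ups l).
Proof.
rewrite map_inj_uniq ?filter_uniq ?iota_uniq // => i j /(congr1 (nth 0 ^~ j)).
by rewrite !nth_incr_nth eqxx; case: eqP => //; lia.
Qed.

Lemma uniq_downs l : is_part l -> uniq (l :: downs l).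
Proof.
move=> lP; rewrite /= map_inj_in_uniq ?filter_uniq ?iota_uniq ?andbT //.
  apply/mapP => -[i]; rewrite mem_filter => /andP[Ri _] /(congr1 (nth 0 ^~ i)).
  by rewrite nth_decr_nth // eqxx; move: Ri; rewrite /removable; lia.
move=> i j; rewrite !mem_filter => /andP[Ri _] /andP[Rj _] /(congr1 (nth 0 ^~ j)).
rewrite !nth_decr_nth // eqxx; move: Rj; rewrite /removable.
by case: eqP => //; lia.
Qed.

Lemma uniq_walks k l : is_part l -> uniq (walks k l).
Proof.
elim: k l => // k IH l lP.
apply: (@allpairs_uniq_dep (seq nat) (fun=> seq (seq nat)) _ (fun h P => l :: h :: P)).
- exact: uniq_downs.
- move=> h h_in; have hP : is_part h.
    by move: h_in; rewrite inE => /predU1P[-> //|]; apply: in_downs_part.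
  apply: (@allpairs_uniq_dep (seq nat) (fun=> seq (seq nat)) _ (fun _ P => P));
    first exact: uniq_ups.
    by move=> m /(in_ups_part hP)/IH.
  move=> _ _ /allpairsPdep[m [P [_ mP ->]]] /allpairsPdep[m' [P' [_ mP' ->]]] /= eqP.
  have mm' : m = m' by rewrite -(walks_head mP) eqP (walks_head mP').
  by rewrite mm' eqP.
by move=> [h P] [h' P'] _ _ /= [-> ->].
Qed.

(** * Ballot words and the scans that act on them *)

Definition letter_count (i : nat) (w : seq nat) : nat := count_mem i w.

Definition lattice_content (w :
  seq nat) := forall i, letter_count i.+1 w <= letter_count i w.

(** Every initial segment of the word must have the content of a partition: this says
that the entries up to any bound form a tableau. *)
Definition ballot (w : seq nat) := forall p q, w = p ++ q -> lattice_content p.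

Definition word_shape (w : seq nat) := foldl (@incr_nth) [::] w.

Lemma letter_count_rcons (w : seq nat) r i :
  letter_count i (rcons w r) = letter_count i w + (i == r).
Proof. by rewrite /letter_count -cats1 count_cat /= addn0 eq_sym. Qed.

Lemma ballot_content w : ballot w -> lattice_content w.
Proof. by move=> wB; apply: (wB _ [::]); rewrite cats0. Qed.

Lemma ballot_catl p q : ballot (p ++ q) -> ballot p.
Proof. by move=> pqB p1 p2 Ep; apply: (pqB p1 (p2 ++ q)); rewrite Ep catA. Qed.

Lemma ballot_nil : ballot [::].
Proof. by move=> [|]. Qed.

Lemma ballot_rcons w r : ballot w -> lattice_content (rcons w r) -> ballot (rcons w r).
Proof.
move=> wB wrC p q; case/lastP: q => [|q y]; first by rewrite cats0 => <-.
by rewrite -rcons_cat => /rcons_inj[Ew _]; apply: wB Ew.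
Qed.

Lemma ballot_rconsl w r : ballot (rcons w r) -> ballot w.
Proof. by rewrite -cats1; apply: ballot_catl. Qed.

Lemma nth_word_shape w i : nth 0 (word_shape w) i = letter_count i w.
Proof.
elim/last_ind: w => [|w r IH]; first by rewrite nth_nil.
by rewrite /word_shape foldl_rcons nth_incr_nth IH letter_count_rcons eq_sym addnC.
Qed.

Lemma word_shape_rcons w r : word_shape (rcons w r) = incr_nth (word_shape w) r.
Proof. by rewrite /word_shape foldl_rcons. Qed.

Lemma content_addable w r : lattice_content (rcons w r) -> addable (word_shape w) r.
Proof.
rewrite /addable !nth_word_shape => wrC; case: r wrC => //= r /(_ r).
by rewrite !letter_count_rcons; lia.
Qed.

Lemma ballot_part w : ballot w -> is_part (word_shape w).
Proof.
elim/last_ind: w => [|w r IH] wB; first by split=> // i; rewrite !nth_nil.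
rewrite word_shape_rcons; apply: is_part_incr; first exact: IH (ballot_rconsl wB).
exact/content_addable/ballot_content.
Qed.

Lemma behead_part l : is_part l -> is_part (behead l).
Proof.
move=> [l0 lS]; split; first by apply: contra l0 => /mem_behead.
by move=> i; rewrite !nth_behead.
Qed.

(** The state is the word written so far and the row [b] of the box added so far. The
next entry [r] is pushed down a row, and the added box with it, exactly when the
added box has taken its place. *)
Definition insert_step (st : seq nat * nat) r :=
  (rcons st.1 (r + (r == st.2)), st.2 + (r == st.2)).

(** The inserted entry itself ends in the first row, hence the letter [0] written
after the smaller entries [w1]. *)
Definition insert_word (w1 u : seq nat) := foldl insert_step (rcons w1 0, 0) u.

Lemma insert_word_rcons w1 u r :
  insert_word w1 (rcons u r) = insert_step (insert_word w1 u) r.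
Proof. exact: foldl_rcons. Qed.

Lemma insert_word_count w1 u i :
  letter_count i (insert_word w1 u).1
    = letter_count i (w1 ++ u) + (i == (insert_word w1 u).2).
Proof.
elim/last_ind: u => [|u r IH]; first by rewrite cats0 letter_count_rcons.
rewrite insert_word_rcons /= -rcons_cat !letter_count_rcons IH.
by case: (eqVneq r (insert_word w1 u).2) => [->|_]; lia.
Qed.

Lemma size_insert_word w1 u : size (insert_word w1 u).1 = (size (w1 ++ u)).+1.
Proof.
elim/last_ind: u => [|u r IH]; first by rewrite cats0 size_rcons.
by rewrite insert_word_rcons /= -rcons_cat !size_rcons IH.
Qed.

Lemma insert_word_ballot w1 u : ballot (w1 ++ u) -> ballot (insert_word w1 u).1.
Proof.
elim/last_ind: u => [|u r IH].
  rewrite cats0 => w1B; apply: ballot_rcons => // i; rewrite !letter_count_rcons.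
  by have := ballot_content w1B i; lia.
rewrite -rcons_cat => wuB; have oB := IH (ballot_rconsl wuB).
rewrite insert_word_rcons /=; apply: ballot_rcons => // i.
have := ballot_content wuB i; have := ballot_content oB i.
have := ballot_content (ballot_rconsl wuB) i.
rewrite !letter_count_rcons !insert_word_count; set b := (insert_word w1 u).2.
by case: (eqVneq r b) => [->|]; lia.
Qed.

Lemma insert_word_below w1 u : 0 \in u -> 0 < (insert_word w1 u).2.
Proof.
elim/last_ind: u => // u r IH;
  rewrite mem_rcons inE insert_word_rcons /= => /predU1P[<-|/IH].
  by case: (insert_word w1 u).2.
by lia.
Qed.

(** Reading [o] backwards, a letter equal to [b] was pushed down from row [b.-1],
unless [b = 0], in which case it is the inserted entry itself. The scan stops
before the word is exhausted because row [b] has a removable box. *)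
Lemma insert_word_inv o b : ballot o -> letter_count b.+1 o < letter_count b o ->
  exists w1 u, insert_word w1 u = (o, b) /\ ballot (w1 ++ u).
Proof.
elim/last_ind: o b => // o r IH b orB; have oB := ballot_rconsl orB.
have := ballot_content orB; rewrite !letter_count_rcons => orC.
have [Er|nrb] := eqVneq r b.
  subst r; case: b orC orB => [|b] orC orB; last first.
    have := orC b; rewrite !letter_count_rcons => orCb rem.
    have [|w1 [u [Eo wuB]]] := IH b oB; first by move: orCb; lia.
    exists w1, (rcons u b); rewrite insert_word_rcons Eo /insert_step /= eqxx addn1.
    split=> //; rewrite -rcons_cat; apply: ballot_rcons => // i.
    have := orC i; have := insert_word_count w1 u i;
      have := insert_word_count w1 u i.+1.
    rewrite Eo /= !letter_count_rcons; move: rem.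
    have := ballot_content oB i.
    case: (eqVneq i b.+1) => [->|]; lia.
  move=> _; exists o, [::]; split; first by [].
  by rewrite cats0.
move=> rem; have [|w1 [u [Eo wuB]]] := IH b oB; first by move: rem nrb; lia.
exists w1, (rcons u r); rewrite insert_word_rcons Eo /insert_step /= (negPf nrb) !addn0.
split=> //; rewrite -rcons_cat; apply: ballot_rcons => // i.
have := orC i; have := insert_word_count w1 u i; have := insert_word_count w1 u i.+1.
rewrite Eo /= !letter_count_rcons; move: rem.
by case: (eqVneq i b) => [->|]; lia.
Qed.

(** The state is the word written so far and the row [b] of the box that is missing so
far. The next entry [r] fills the hole when its own place is directly below the
hole; if it is directly right of the hole it moves without changing its row. *)
Definition delete_step (st : seq nat * nat) r :=
  if (r == st.2.+1) && (letter_count st.2 st.1 == letter_count r st.1)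
  then (rcons st.1 st.2, r) else (rcons st.1 r, st.2).

Definition delete_word (w1 : seq nat) (a : nat) (u :
  seq nat) := foldl delete_step (w1, a) u.

Lemma delete_word_rcons w1 a u r :
  delete_word w1 a (rcons u r) = delete_step (delete_word w1 a u) r.
Proof. exact: foldl_rcons. Qed.

Lemma delete_word_count w1 a u i :
  letter_count i (w1 ++ a ::
    u) = letter_count i (delete_word w1 a u).1 + (i == (delete_word w1 a u).2).
Proof.
elim/last_ind: u => [|u r IH]; first by rewrite cats1 letter_count_rcons.
rewrite delete_word_rcons -rcons_cons -rcons_cat letter_count_rcons IH /delete_step.
by case: ifP => /= _; rewrite letter_count_rcons; lia.
Qed.

Lemma delete_word_cat w1 a u :
  exists2 u', (delete_word w1 a u).1 = w1 ++ u' & size u' = size u.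
Proof.
elim/last_ind: u => [|u r [u' E sz]]; first by exists [::]; rewrite ?cats0.
rewrite delete_word_rcons /delete_step E; case: ifP => _ /=.
  by exists (rcons u' (delete_word w1 a u).2); rewrite ?rcons_cat ?size_rcons ?sz.
by exists (rcons u' r); rewrite ?rcons_cat ?size_rcons ?sz.
Qed.

Lemma delete_word_ballot w1 a u : ballot (w1 ++ a ::
  u) -> ballot (delete_word w1 a u).1.
Proof.
elim/last_ind: u => [|u r IH]; first by apply: ballot_catl.
rewrite -rcons_cons -rcons_cat => wuB; have wB := ballot_rconsl wuB; have oB := IH wB.
have E := delete_word_count w1 a u.
rewrite delete_word_rcons /delete_step; move: oB E; set o := (delete_word w1 a u).1;
  set b := (delete_word w1 a u).2.
move=> oB E; case: ifPn => [/andP[/eqP Er _]|nsw] /=; apply: ballot_rcons => // i.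
  by have := ballot_content wB i; rewrite !E !letter_count_rcons.
have := ballot_content wuB i; have := ballot_content oB i;
  rewrite !letter_count_rcons !E.
move: nsw; case: (eqVneq i b) => [->|ib]; last by lia.
by case: (eqVneq r b.+1) => [->|]; lia.
Qed.

(** Any place in the word can be that of the deleted entry. Reading backwards, a last
letter [r] has come up from row [b = r.+1] exactly when the rows [r] and [b] are
equally long before that letter, so that no box could be added to row [b] there. *)
Lemma delete_word_inv w1 o b :
  ballot (w1 ++ o) -> lattice_content (rcons (w1 ++ o) b) ->
  exists a u, [/\ delete_word w1 a u = (w1 ++ o, b), size u = size o &
    ballot (w1 ++ a :: u)].
Proof.
elim/last_ind: o b => [|o r IH] b.
  rewrite cats0 => w1B wbC; exists b, [::]; split=> //.
  by rewrite cats1; apply: ballot_rcons.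
rewrite -rcons_cat => orB orbC; have oB := ballot_rconsl orB.
have orC := ballot_content orB; have oC := ballot_content oB.
have [/andP[/eqP Eb /eqP Ec]|nsw] :=
    boolP ((b == r.+1) && (letter_count r (w1 ++ o) == letter_count b (w1 ++ o))).
  subst b; have [a [u [Eo sz wuB]]] := IH r oB orC.
  exists a, (rcons u r.+1); rewrite delete_word_rcons Eo /delete_step /= Ec !eqxx !size_rcons sz.
  split=> //; rewrite -rcons_cons -rcons_cat; apply: ballot_rcons => // i.
  have := orbC i; rewrite !letter_count_rcons !delete_word_count Eo /=; lia.
have [|a [u [Eo sz wuB]]] := IH b oB.
  move=> i; have := orbC i; have := oC i; have := orC i; rewrite !letter_count_rcons.
  by move: nsw; case: (eqVneq i r) => [->|]; case: (eqVneq b r.+1) => [->|]; lia.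
exists a, (rcons u r); rewrite delete_word_rcons Eo /delete_step /=.
have -> : (r == b.+1) && (letter_count b (w1 ++ o) == letter_count r (w1 ++ o)) = false.
  apply/negbTE/negP => /andP[/eqP Er /eqP]; subst r; have := orC b.
  by rewrite !letter_count_rcons; lia.
rewrite !size_rcons sz; split=> //; rewrite -rcons_cons -rcons_cat.
apply: ballot_rcons => // i.
by have := orbC i; rewrite !letter_count_rcons !delete_word_count Eo /=; lia.
Qed.

(** * Tableaux as ballot words, and row insertion *)

(** For [v] larger than all entries of [T], this adds a box with entry [v] to row [r]. *)
Definition push (r v : nat) (T : tableau) : tableau :=
  set_nth [::] T r (rcons (nth [::] T r) v).

Lemma shape_push r v T : tableau_shape (push r v T) = incr_nth (tableau_shape T) r.
Proof.
elim: T r => [|R T IH] [|r] //=; first by elim: r => //= r [->].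
  by rewrite /push /= size_rcons.
by congr (_ :: _); apply: IH.
Qed.

Lemma all_push p r v T : all p (flatten (push r v T)) = p v && all p (flatten T).
Proof.
elim: T r => [|R T IH] [|r] //=; first by rewrite andbT; elim: r => //=; rewrite andbT.
  by rewrite !all_cat all_rcons andbA.
by rewrite all_cat -/(push r v T) IH andbCA all_cat.
Qed.

(** The row that receives the new box in [rsk_insert x T]. *)
Fixpoint rsk_row (x : nat) (T : tableau) : nat :=
  if T is R :: T' then
    if has (fun z => x < z) R then (rsk_row (seq_min [seq z <- R | x < z]) T').+1 else 0
  else 0.

Lemma foldr_minn_in (d : nat) s : foldr minn d s \in d :: s.
Proof.
elim: s => [|y s IH] /=; first by rewrite inE eqxx.
rewrite /minn; case: ltnP => _; first by rewrite !inE eqxx orbT.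
by move: IH; rewrite !inE => /orP[->|->]; rewrite ?orbT.
Qed.

Lemma seq_min_in s : s != [::] -> seq_min s \in s.
Proof.
case: s => // y s _; have := foldr_minn_in y (y :: s).
by rewrite inE => /predU1P[E|//]; rewrite [seq_min _]E mem_head.
Qed.

Lemma seq_min_rcons s v : s != [::] -> all (ltn^~ v) s ->
  seq_min (rcons s v) = seq_min s.
Proof.
case: s => // y s _ /= /andP[lt_yv _].
by rewrite /seq_min /= foldr_rcons (minn_idPr (ltnW lt_yv)).
Qed.

Lemma rsk_top x T : all (ltn^~ x) (flatten T) ->
  rsk_insert x T = push 0 x T /\ rsk_row x T = 0.
Proof.
case: T => //= R T; rewrite all_cat => /andP[ltRx _].
have -> : has (fun z => x < z) R = false.
  by apply/hasPn => z /(allP ltRx) /=; lia.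
by [].
Qed.

(** A new largest entry [v] at the end of row [r] interferes with the insertion of [x]
only if the bumping stops in row [r]; then [v] is bumped, to the end of the next row. *)
Lemma rsk_push x r v T :
  r <= size T -> all (ltn^~ v) (flatten T) -> x < v ->
  rsk_insert x (push r v T) = push (r + (r == rsk_row x T)) v (rsk_insert x T) /\
  rsk_row x (push r v T) = rsk_row x T + (r == rsk_row x T).
Proof.
elim: T r x => [|R T IH] r x.
  by rewrite leqn0 => /eqP -> _ lt_xv; rewrite /= lt_xv /= /seq_min /= minnn eqxx.
rewrite /= all_cat => ler /andP[ltRv ltTv] lt_xv.
have fin : has (fun z => x < z) R -> [seq z <- R | x < z] != [::] by rewrite has_filter.
case: r ler => [|r] ler; rewrite /= -/(push _ _ _).
  rewrite has_rcons filter_rcons lt_xv /=.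
  case hasR: (has _ R) => /=.
    rewrite seq_min_rcons ?fin //; last by apply/allP => z;
      rewrite mem_filter => /andP[_ /(allP ltRv)].
    set y := seq_min _; have /(allP ltRv) /= ltyv : y \in R.
      by have := seq_min_in (fin hasR); rewrite mem_filter => /andP[].
    by rewrite map_rcons [v == y]gtn_eqF //= !addn0.
  have -> : [seq z <- R | x < z] = [::].
    by apply/eqP; move: hasR; rewrite has_filter => /negbFE.
  have -> : seq_min (rcons [::] v) = v by rewrite /seq_min /= minnn.
  rewrite map_rcons eqxx; have [-> ->] := rsk_top ltTv; split=> //=.
  congr (rcons _ _ :: _); apply: map_id_in => z /(allP ltRv) /= ltzv.
  by rewrite ltn_eqF.
case hasR: (has _ R) => /=; last by rewrite !addn0.
set y := seq_min _; have /(allP ltRv) /= ltyv : y \in R.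
  by have := seq_min_in (fin hasR); rewrite mem_filter => /andP[].
by have [-> ->] := IH r y ler ltTv ltyv; rewrite eqSS.
Qed.

Definition tableau_of (vs w : seq nat) : tableau :=
  foldl (fun T vr => push vr.2 vr.1 T) [::] (zip vs w).

Lemma tableau_of_rcons vs v w r : size vs = size w ->
  tableau_of (rcons vs v) (rcons w r) = push r v (tableau_of vs w).
Proof. by move=> sz; rewrite /tableau_of zip_rcons // foldl_rcons. Qed.

Lemma shape_tableau_of vs w :
  size vs = size w -> tableau_shape (tableau_of vs w) = word_shape w.
Proof.
elim/last_ind: w vs => [|w r IH] vs; first by move/size0nil->.
case/lastP: vs => [|vs v]; rewrite !size_rcons // => -[sz].
by rewrite tableau_of_rcons // shape_push IH // word_shape_rcons.
Qed.

Lemma all_tableau_of p vs w :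
  size vs = size w -> all p (flatten (tableau_of vs w)) = all p vs.
Proof.
elim/last_ind: w vs => [|w r IH] vs; first by move/size0nil->.
case/lastP: vs => [|vs v]; rewrite !size_rcons // => -[sz].
by rewrite tableau_of_rcons // all_push IH // all_rcons.
Qed.

Lemma sorted_rcons_all (s : seq nat) v : sorted ltn (rcons s v) -> all (ltn^~ v) s.
Proof.
rewrite (sorted_pairwise ltn_trans) -cats1 pairwise_cat allrel1r.
by case/andP.
Qed.

Lemma sorted_rconsl (s : seq nat) v : sorted ltn (rcons s v) -> sorted ltn s.
Proof.
by rewrite !(sorted_pairwise ltn_trans) -cats1 pairwise_cat => /and3P[].
Qed.

Lemma rsk_tableau_of vs1 x vs2 w1 u :
  size vs1 = size w1 -> size vs2 = size u ->
  sorted ltn (vs1 ++ x :: vs2) -> ballot (w1 ++ u) ->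
  rsk_insert x (tableau_of (vs1 ++ vs2) (w1 ++ u)) = tableau_of (vs1 ++ x ::
    vs2) (insert_word w1 u).1 /\
  rsk_row x (tableau_of (vs1 ++ vs2) (w1 ++ u)) = (insert_word w1 u).2.
Proof.
move=> sz1; elim/last_ind: u vs2 => [|u r IH] vs2.
  move/size0nil->; rewrite cats1 !cats0 => /sorted_rcons_all lt1x _.
  have [|-> ->] := @rsk_top x (tableau_of vs1 w1); first by rewrite all_tableau_of.
  by rewrite /insert_word /= tableau_of_rcons.
case/lastP: vs2 => [|vs2 v]; rewrite !size_rcons // => -[sz2].
rewrite -rcons_cons -!rcons_cat => srt wuB.
have szT : size (vs1 ++ vs2) = size (w1 ++ u) by rewrite !size_cat sz1 sz2.
have [IH1 IH2] := IH _ sz2 (sorted_rconsl srt) (ballot_rconsl wuB).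
have := sorted_rcons_all srt; rewrite all_cat /= => /and3P[lt1 lt_xv lt2].
rewrite tableau_of_rcons // insert_word_rcons /insert_step.
have [|||-> ->] := @rsk_push x r v (tableau_of (vs1 ++ vs2) (w1 ++ u)) => //.
- rewrite -(size_map size) -/(tableau_shape _) shape_tableau_of //.
  exact/addable_size/content_addable/ballot_content.
- by rewrite all_tableau_of // all_cat lt1.
rewrite IH1 IH2 tableau_of_rcons ?size_insert_word ?size_cat //=.
by rewrite addnS sz1 sz2.
Qed.

(** * Jeu de taquin deletion on ballot words *)

Local Notation row T i := (nth [::] T i).

Lemma nth_shape T i : nth 0 (tableau_shape T) i = size (row T i).
Proof.
case: (ltnP i (size T)) => leT; first by rewrite (nth_map [::]).
by rewrite !nth_default // size_map.
Qed.

Lemma tableau_ext T1 T2 :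
  is_part (tableau_shape T1) -> is_part (tableau_shape T2) ->
  (forall i, row T1 i = row T2 i) -> T1 = T2.
Proof.
move=> [T1p _] [T2p _]; apply: eq_from_nth_notin.
  by apply: contra T1p => /(map_f size).
by apply: contra T2p => /(map_f size).
Qed.

Lemma row_push r v T i : row (push r v T) i
  = if i == r then rcons (row T r) v else row T i.
Proof. by rewrite nth_set_nth. Qed.

Lemma row_set_entry T i j x k :
  row (set_entry T i j x) k = if k == i then set_nth 0 (row T i) j x else row T k.
Proof. by rewrite nth_set_nth. Qed.

Lemma shape_set_entry T i j x : has_box T i j ->
  tableau_shape (set_entry T i j x) = tableau_shape T.
Proof.
move=> Tij; have lt_iT : i < size T.
  by rewrite ltnNge; apply: contraL Tij => leT; rewrite /has_box nth_default.
apply: (@eq_from_nth _ 0); rewrite !size_map size_set_nth (maxn_idPr _) // => k _.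
rewrite !nth_shape row_set_entry; case: eqP => // ->.
by rewrite size_set_nth; apply/maxn_idPr.
Qed.

Lemma has_boxE T i j : has_box T i j = (j < nth 0 (tableau_shape T) i).
Proof. by rewrite nth_shape. Qed.

Lemma shape_exchange T i j i' j' : has_box T i j -> has_box T i' j' ->
  tableau_shape (exchange T i j i' j') = tableau_shape T.
Proof.
move=> B B'; rewrite /exchange shape_set_entry ?shape_set_entry //.
by rewrite has_boxE shape_set_entry // -has_boxE.
Qed.

Lemma entry_set_entry T i j x k l :
  entry (set_entry T i j x) k l = if (k == i) && (l == j) then x else entry T k l.
Proof.
rewrite /entry row_set_entry; case: (eqVneq k i) => [->|] //=.
by rewrite nth_set_nth /=.
Qed.

Lemma map_size_set_nth (T : tableau) i (R : seq nat) :
  map size (set_nth [::] T i R) = set_nth 0 (map size T) i (size R).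
Proof.
by elim: T i => [|Q T IH] [|i] //=; [elim: i => //= i [->] | rewrite IH].
Qed.

(** The filter of [delete_corner] on rows and that of [decr_nth] on parts agree. *)
Lemma shape_delete_corner T i :
  tableau_shape (delete_corner T i) = decr_nth (tableau_shape T) i.
Proof.
rewrite /delete_corner /decr_nth nth_shape /tableau_shape.
set R := take _ _; have <- : size R = (size (row T i)).-1.
  by rewrite size_take; case: ltnP; lia.
by rewrite -map_size_set_nth filter_map; congr (map _ _); apply: eq_filter => Q;
  rewrite /= size_eq0.
Qed.

Lemma row_delete_corner T i k :
  is_part (tableau_shape T) -> removable (tableau_shape T) i ->
  row (delete_corner T i) k
    = if k == i then take (size (row T i)).-1 (row T i) else row T k.
Proof.
move=> [_ TS]; rewrite /removable !nth_shape => Ti.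
rewrite nth_filter_neq ?nth_set_nth // => j.
rewrite !nth_set_nth /=; have := TS j; rewrite !nth_shape => TSj.
case: (eqVneq j i) => [->|_] E.
  have Ei : size (row T i) <= 1 by move/(congr1 size): E; rewrite size_take /=;
    case: ltnP; lia.
  by rewrite gtn_eqF //; apply: size0nil; lia.
case: (eqVneq j.+1 i) => [Ej|_]; last by apply: size0nil; rewrite E in TSj;
  move: TSj => /=; lia.
by move: Ti; rewrite -Ej; move: TSj; rewrite E /=; lia.
Qed.

Lemma has_box_push r v T i j :
  has_box (push r v T) i j = has_box T i j || (i == r) && (j == size (row T r)).
Proof.
rewrite /has_box row_push; case: (eqVneq i r) => [->|]; rewrite ?orbF //=.
by rewrite size_rcons ltnS leq_eqVlt orbC.
Qed.

Lemma entry_push r v T i j : has_box T i j -> entry (push r v T) i j = entry T i j.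
Proof.
rewrite /entry /has_box row_push; case: (eqVneq i r) => [->|] // lt_j.
by rewrite nth_rcons lt_j.
Qed.

Lemma entry_push_new r v T : entry (push r v T) r (size (row T r)) = v.
Proof. by rewrite /entry row_push eqxx nth_rcons ltnn eqxx. Qed.

Lemma set_nth_rcons (s : seq nat) v j x : j < size s ->
  set_nth 0 (rcons s v) j x = rcons (set_nth 0 s j x) v.
Proof. by elim: s j => // y s IH [|j] //= ?; rewrite IH. Qed.

Lemma set_nth_last (s : seq nat) x y : set_nth 0 (rcons s x) (size s) y = rcons s y.
Proof. by elim: s => //= z s ->. Qed.

Lemma take_rcons (s : seq nat) x : take (size (rcons s x)).-1 (rcons s x) = s.
Proof. by rewrite size_rcons -cats1 take_size_cat. Qed.

Lemma set_entry_push r v T i j x :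
  is_part (tableau_shape T) -> addable (tableau_shape T) r -> has_box T i j ->
  set_entry (push r v T) i j x = push r v (set_entry T i j x).
Proof.
move=> TP Ar Tij; have P1 := is_part_incr TP Ar.
apply: tableau_ext => [||k].
- by rewrite shape_set_entry ?shape_push // has_box_push Tij.
- by rewrite shape_push shape_set_entry.
rewrite row_set_entry !row_push !row_set_entry.
case: (eqVneq k i) => [->|ki].
  by case: (eqVneq i r) => [Ei|//]; rewrite -Ei ?eqxx set_nth_rcons.
by case: (eqVneq k r) => [Ek|//]; rewrite -Ek (negPf ki).
Qed.

Lemma exchange_push r v T i j i' j' :
  is_part (tableau_shape T) -> addable (tableau_shape T) r ->
  has_box T i j -> has_box T i' j' ->
  exchange (push r v T) i j i' j' = push r v (exchange T i j i' j').
Proof.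
move=> TP Ar B B'; rewrite /exchange !entry_push // set_entry_push //.
by rewrite set_entry_push ?shape_set_entry // has_boxE shape_set_entry // -has_boxE.
Qed.

(** The graph of [jdt_slide], restricted to runs that end with the deletion of a corner
before the fuel is exhausted, and recording the row [a] of that corner. *)
Inductive slide : nat -> tableau -> nat -> nat -> nat -> tableau -> Prop :=
| slide_stop n T i j of ~~ has_box T i.+1 j & ~~ has_box T i j.+1 :
    slide n.+1 T i j i (delete_corner T i)
| slide_down n T i j a T' of has_box T i.+1 j
    & (has_box T i j.+1 ==> (entry T i.+1 j < entry T i j.+1))
    & slide n (exchange T i j i.+1 j) i.+1 j a T' : slide n.+1 T i j a T'
| slide_right n T i j a T' of has_box T i j.+1
    & (has_box T i.+1 j ==> ~~ (entry T i.+1 j < entry T i j.+1))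
    & slide n (exchange T i j i j.+1) i j.+1 a T' : slide n.+1 T i j a T'.

Lemma slide_jdt n T i j a T' : slide n T i j a T' -> jdt_slide n T i j = T'.
Proof.
elim=> {n T i j a T'} [n T i j /negPf nd /negPf nr|n T i j a T' d + _ IH|n T i j a T' r + _ IH].
- by rewrite /= nd nr.
- by rewrite /= d; case: has_box => //= ->.
by rewrite /= r; case: has_box => //= /negPf ->.
Qed.

Definition bounded v T := forall i j, has_box T i j -> entry T i j < v.

Lemma bounded_exchange v T i j i' j' : has_box T i j -> has_box T i' j' ->
  bounded v T -> bounded v (exchange T i j i' j').
Proof.
move=> B B' Tv k l; rewrite has_boxE shape_exchange // -has_boxE => Bkl.
by rewrite !entry_set_entry; case: ifP => _; [|case: ifP => _]; apply: Tv.
Qed.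

(** In the three lemmas that follow, the slide of [T] stops at the corner of row [i].
If [v] stands to the right of that corner, it moves one box to the left. *)
Lemma exchange_corner_right T i j v :
  is_part (tableau_shape T) -> addable (tableau_shape T) i ->
    removable (tableau_shape T) i ->
  size (row T i) = j.+1 ->
  delete_corner (exchange (push i v T) i j i j.+1) i = push i v (delete_corner T i).
Proof.
move=> TP Ai Ri szT.
have B : has_box (push i v T) i j by rewrite /has_box row_push eqxx size_rcons szT; lia.
have B' : has_box (push i v T) i j.+1 by rewrite /has_box row_push eqxx size_rcons szT;
  lia.
have [Ri' E'] := decr_incr TP Ai; have [Ai' E''] := incr_decr TP Ri.
have shE : tableau_shape (exchange (push i v T) i j i j.+1)
  = incr_nth (tableau_shape T) i.
  by rewrite shape_exchange // shape_push.
apply: tableau_ext => [||k].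
- by rewrite shape_delete_corner shE E'.
- by rewrite shape_push shape_delete_corner E''.
rewrite row_delete_corner ?shE //; last exact: is_part_incr.
rewrite row_push !row_delete_corner // eqxx !row_set_entry !row_push !eqxx.
case: (eqVneq k i) => [_|//].
rewrite /entry !row_push eqxx !nth_rcons szT ltnSn ltnn eqxx.
case/lastP E: (row T i) szT => [//|s x]; rewrite size_rcons => -[sz].
rewrite -sz set_nth_rcons ?size_rcons // set_nth_last.
rewrite -[in LHS](size_rcons s v) set_nth_last take_rcons; congr (rcons _ _).
by rewrite -[LHS](take_rcons s x) size_rcons.
Qed.

(** If [v] stands below the corner, it moves up into row [i]. *)
Lemma exchange_corner_down T i j v :
  is_part (tableau_shape T) -> addable (tableau_shape T) i.+1 ->
  removable (tableau_shape T) i ->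
  size (row T i) = j.+1 -> size (row T i.+1) = j ->
  delete_corner (exchange (push i.+1 v T) i j i.+1 j) i.+1
    = push i v (delete_corner T i).
Proof.
move=> TP Ai Ri szT szT'.
have Nii : i == i.+1 = false by rewrite ltn_eqF.
have Nii' : i.+1 == i = false by rewrite gtn_eqF.
have B : has_box (push i.+1 v T) i j by rewrite /has_box row_push Nii szT; lia.
have B' : has_box (push i.+1 v T) i.+1 j
  by rewrite /has_box row_push eqxx size_rcons szT'; lia.
have [Ri' E'] := decr_incr TP Ai; have [Ai' E''] := incr_decr TP Ri.
have shE : tableau_shape (exchange (push i.+1 v T) i j i.+1 j)
         = incr_nth (tableau_shape T) i.+1.
  by rewrite shape_exchange // shape_push.
apply: tableau_ext => [||k].
- by rewrite shape_delete_corner shE E'.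
- by rewrite shape_push shape_delete_corner E''.
rewrite row_delete_corner ?shE //; last exact: is_part_incr.
rewrite row_push !row_delete_corner // !eqxx !row_set_entry !row_push !eqxx ?Nii ?Nii'.
rewrite /entry !row_push !eqxx ?Nii nth_rcons szT' ltnn eqxx -szT'.
have [->|ki1] := eqVneq k i.+1.
  by rewrite Nii' set_nth_last take_rcons.
have [_|//] := eqVneq k i.
case/lastP E: (row T i) szT => [//|s x]; rewrite size_rcons szT' => -[<-].
rewrite set_nth_last; congr (rcons _ _).
by rewrite -[LHS](take_rcons s x) size_rcons.
Qed.

(** If [v] touches neither side of the corner, it stays. *)
Lemma delete_corner_push T i r v :
  is_part (tableau_shape T) -> addable (tableau_shape T) r -> i != r ->
  removable (incr_nth (tableau_shape T) r) i ->
  delete_corner (push r v T) i = push r v (delete_corner T i).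
Proof.
move=> TP Ar ir Ri'; have P' := is_part_incr TP Ar.
have ri : r != i by rewrite eq_sym.
have [E1 E2] := incr_decr_comm TP ri.
have ARi : addable (tableau_shape T) r
  && removable (incr_nth (tableau_shape T) r) i by rewrite Ar.
have := ARi; rewrite E1 => /andP[Ri Ar'].
apply: tableau_ext => [||k].
- by rewrite shape_delete_corner shape_push; apply: is_part_decr.
- by rewrite shape_push shape_delete_corner; apply: is_part_incr => //;
  apply: is_part_decr.
rewrite row_delete_corner ?shape_push // !row_push !row_delete_corner //.
by rewrite (negPf ir) (negPf ri); case: (eqVneq k i) => [->|//]; rewrite (negPf ir).
Qed.

(** Until the slide reaches its final corner, a new largest entry [v] is never the
smaller of the two candidates, so it does not influence the path. One extra unit of
fuel pays for the exchange with [v]. *)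
Lemma slide_push n T i j a T' r v : slide n T i j a T' ->
  is_part (tableau_shape T) -> addable (tableau_shape T) r -> bounded v T ->
    has_box T i j ->
  let sw := (r == a.+1) && (nth 0 (tableau_shape T) a == (nth 0 (tableau_shape T) r).+1) in
  slide n.+1 (push r v T) i j (if sw then r else a) (push (if sw then a else r) v T').
Proof.
elim=> {n T i j a T'} [n T i j nd nr|n T i j a T' d c _ IH|n T i j a T' rt c _ IH]
  TP Ar Tv Tij sw.
- have szi : size (row T i) = j.+1 by move: nr Tij; rewrite /has_box; lia.
  have szi1 : size (row T i.+1) <= j by move: nd; rewrite /has_box; lia.
  have Ri : removable (tableau_shape T) i by rewrite /removable !nth_shape szi; lia.
  have TS k : size (row T k.+1) <= size (row T k) by rewrite -!nth_shape TP.2.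
  have [ri|ri] := eqVneq r i.
    subst r; rewrite {}/sw ltn_eqF //=; rewrite -(exchange_corner_right (j := j)) //.
    have shE : tableau_shape (exchange (push i v T) i j i j.+1)
      = tableau_shape (push i v T).
      by rewrite shape_exchange ?has_box_push ?Tij // eqxx szi eqxx orbT.
    apply: slide_right; last apply: slide_stop.
    + by rewrite has_box_push eqxx szi eqxx orbT.
    + by rewrite has_box_push (negPf nd) gtn_eqF.
    + rewrite has_boxE shE -has_boxE has_box_push gtn_eqF // orbF /has_box; lia.
    + rewrite has_boxE shE -has_boxE has_box_push /has_box szi; lia.
  case: ifPn => [/andP[/eqP ri1]|nsw].
    subst r; rewrite !nth_shape szi eqSS => /eqP szi1'.
    rewrite -(exchange_corner_down (j := j)) //.
    have shE : tableau_shape (exchange (push i.+1 v T) i j i.+1 j)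
      = tableau_shape (push i.+1 v T).
      by rewrite shape_exchange ?has_box_push ?Tij // eqxx -szi1' eqxx orbT.
    apply: slide_down; last apply: slide_stop.
    + by rewrite has_box_push eqxx -szi1' eqxx orbT.
    + by rewrite has_box_push (negPf nr) ltn_eqF.
    + rewrite has_boxE shE -has_boxE has_box_push gtn_eqF // orbF /has_box.
      by have := TS i.+1; lia.
    + rewrite has_boxE shE -has_boxE has_box_push /has_box; lia.
  rewrite -delete_corner_push //; [|by rewrite eq_sym|]; last first.
    rewrite /removable !nth_incr_nth (negPf ri) !nth_shape szi; move: nsw.
    rewrite {}/sw !nth_shape szi; case: (eqVneq r i.+1) => [->|_] /=; lia.
  apply: slide_stop; rewrite has_box_push negb_or ?nd ?nr.
    move: nsw; rewrite {}/sw !nth_shape szi eq_sym; case: eqP => //= _; lia.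
  by rewrite eq_sym (negPf ri).
- have shE : tableau_shape (exchange T i j i.+1 j)
  = tableau_shape T by rewrite shape_exchange.
  apply: slide_down; first by rewrite has_box_push d.
    rewrite has_box_push; move: c; have [Bj c|_ _] /= := boolP (has_box T i j.+1).
      by rewrite !entry_push.
    apply/implyP => /andP[/eqP ? /eqP Ej]; subst r.
    by rewrite entry_push // Ej entry_push_new Tv.
  rewrite exchange_push // /sw -shE; apply: IH; rewrite ?shE //.
    exact: bounded_exchange.
  by rewrite has_boxE shE -has_boxE.
have shE : tableau_shape (exchange T i j i j.+1)
  = tableau_shape T by rewrite shape_exchange.
apply: slide_right; first by rewrite has_box_push rt.
  rewrite has_box_push; move: c; have [Bj c|_ _] /= := boolP (has_box T i.+1 j).
    by rewrite !entry_push.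
  apply/implyP => /andP[/eqP ? /eqP Ej]; subst r.
  have lt_v := Tv _ _ rt; rewrite (entry_push _ _ rt) [entry _ _ j](_ : _ = v);
    first by lia.
  by rewrite Ej entry_push_new.
rewrite exchange_push // /sw -shE; apply: IH; rewrite ?shE //.
  exact: bounded_exchange.
by rewrite has_boxE shE -has_boxE.
Qed.

Definition row_of (x : nat) (T : tableau) := find (fun R => x \in R) T.

Definition jdt_to x T a T' :=
  slide (sumn (tableau_shape T)) T (row_of x T) (index x (row T (row_of x T))) a T'.

Lemma jdt_toE x T a T' : jdt_to x T a T' -> jdt_delete x T = T'.
Proof. exact: slide_jdt. Qed.

Lemma mem_row_of x T : (x \in flatten T) -> x \in row T (row_of x T).
Proof.
move=> xT; apply: (nth_find _ (a := fun R => x \in R)).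
by apply/hasP; have /flattenP[R RT xR] := xT; exists R.
Qed.

Lemma row_of_push r v x T : x \in flatten T -> x != v -> r <= size T ->
  row_of x (push r v T) = row_of x T.
Proof.
move=> + xv; elim: T r => [|R T IH] [|r] //=; rewrite mem_cat /row_of /=.
  by rewrite mem_rcons inE (negPf xv).
by case: (x \in R) => //= xT ler; congr _.+1; apply: IH.
Qed.

Lemma row_of_push_new r x T : x \notin flatten T -> r <= size T ->
  row_of x (push r x T) = r.
Proof.
elim: T r => [|R T IH] [|r] //=; rewrite /row_of /=.
- by rewrite inE eqxx.
- by rewrite mem_rcons inE eqxx.
by rewrite mem_cat negb_or => /andP[/negPf -> xT] ler; congr _.+1; apply: IH.
Qed.

Lemma sumn_incr_nth l r : sumn (incr_nth l r) = (sumn l).+1.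
Proof.
by elim: l r => [|n l IH] [|r] //=; [elim: r | rewrite IH addnS].
Qed.

Lemma all_bounded v T : all (ltn^~ v) (flatten T) -> bounded v T.
Proof.
move=> Tv i j; rewrite /has_box /entry => lt_j.
apply: (allP Tv); apply/flattenP; exists (row T i); last exact: mem_nth.
by apply: mem_nth; rewrite ltnNge; apply: contraL lt_j => le_iT;
  rewrite [row T i]nth_default.
Qed.

(** The deletion of the largest entry is the base of the scan: it stands in a corner. *)
Lemma jdt_push_new x r T : is_part (tableau_shape T) -> addable (tableau_shape T) r ->
  x \notin flatten T -> jdt_to x (push r x T) r T.
Proof.
move=> TP Ar xT; have leT := addable_size Ar; rewrite size_map in leT.
rewrite /jdt_to row_of_push_new // shape_push sumn_incr_nth row_push eqxx.
have xR : x \notin row T r.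
  apply: contra xT => xR; apply/flattenP; exists (row T r) => //.
  by apply: mem_nth; rewrite ltnNge; apply: contraL xR => ?; rewrite nth_default.
rewrite -cats1 index_cat (negPf xR) /= eqxx addn0.
have [Ri E] := decr_incr TP Ar.
have TE : delete_corner (push r x T) r = T.
  apply: tableau_ext => //; first by rewrite shape_delete_corner shape_push E.
  move=> k; rewrite row_delete_corner ?shape_push //; last exact: is_part_incr.
  by rewrite !row_push eqxx take_rcons; case: eqP => // ->.
have TS := TP.2 r; rewrite !nth_shape in TS.
rewrite -[X in slide _ _ _ _ _ X]TE.
apply: slide_stop; rewrite has_box_push.
  by rewrite gtn_eqF // orbF /has_box; lia.
by rewrite /has_box eqxx gtn_eqF //=; lia.
Qed.

(** The fuel in [jdt_delete] is the number of boxes, which grows by one with [v], as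
[slide_push] requires. *)
Lemma jdt_push x T a T' r v : jdt_to x T a T' ->
  is_part (tableau_shape T) -> addable (tableau_shape T) r ->
  all (ltn^~ v) (flatten T) -> x \in flatten T ->
  let sw := (r == a.+1) && (nth 0 (tableau_shape T) a == (nth 0 (tableau_shape T) r).+1) in
  jdt_to x (push r v T) (if sw then r else a) (push (if sw then a else r) v T').
Proof.
move=> xTT' TP Ar Tv xT sw; have leT := addable_size Ar; rewrite size_map in leT.
have /= lt_xv := allP Tv _ xT; have xv : x != v by rewrite ltn_eqF.
have xR := mem_row_of xT.
rewrite /jdt_to row_of_push // shape_push sumn_incr_nth.
have -> : index x (row (push r v T) (row_of x T)) = index x (row T (row_of x T)).
  rewrite row_push; case: eqP => // <-.
  by rewrite -cats1 index_cat xR.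
apply: slide_push => //; first exact: all_bounded.
by rewrite /has_box index_mem.
Qed.

Lemma jdt_tableau_of vs1 x vs2 w1 a u :
  size vs1 = size w1 -> size vs2 = size u ->
  sorted ltn (vs1 ++ x :: vs2) -> ballot (w1 ++ a :: u) ->
  jdt_to x (tableau_of (vs1 ++ x :: vs2) (w1 ++ a :: u)) (delete_word w1 a u).2
    (tableau_of (vs1 ++ vs2) (delete_word w1 a u).1).
Proof.
move=> sz1; elim/last_ind: u vs2 => [|u r IH] vs2.
  move/size0nil->; rewrite !cats1 !cats0 => /sorted_rcons_all lt1x w1B.
  have w1B' := ballot_rconsl w1B.
  rewrite tableau_of_rcons //; apply: jdt_push_new; rewrite ?shape_tableau_of //.
  - exact: ballot_part.
  - exact/content_addable/ballot_content.
  have : all (ltn^~ x) (flatten (tableau_of vs1 w1)) by rewrite all_tableau_of.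
  by apply: contraL => xT; apply/allPn; exists x; rewrite //= ltnn.
case/lastP: vs2 => [|vs2 v]; rewrite !size_rcons // => -[sz2].
rewrite -!rcons_cons -!rcons_cat => srt wuB.
have szT : size (vs1 ++ x :: vs2) = size (w1 ++ a :: u) by rewrite !size_cat /= sz1 sz2.
have wuB' := ballot_rconsl wuB.
have {}IH := IH _ sz2 (sorted_rconsl srt) wuB'.
have lt_v := sorted_rcons_all srt.
rewrite tableau_of_rcons //.
have := jdt_push (r := r) (v := v) IH; rewrite shape_tableau_of // all_tableau_of //.
have xT : x \in flatten (tableau_of (vs1 ++ x :: vs2) (w1 ++ a :: u)).
  have := all_tableau_of (predC1 x) szT; rewrite all_cat /= eqxx andbF.
  by move/negbT/allPn => [y yT /=]; rewrite negbK => /eqP E; rewrite -{1}E.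
have sz_o : size (vs1 ++ vs2) = size (delete_word w1 a u).1.
  by have [u' -> szu'] := delete_word_cat w1 a u; rewrite !size_cat sz1 sz2 szu'.
move/(_ (ballot_part wuB') (content_addable (ballot_content wuB)) lt_v xT).
rewrite /= !nth_word_shape !delete_word_count delete_word_rcons /delete_step.
set o := (delete_word w1 a u).1 in sz_o *; set b := (delete_word w1 a u).2.
have -> : (r == b.+1) && (letter_count b o + (b == b) == (letter_count r o + (r == b)).+1)
        = (r == b.+1) && (letter_count b o == letter_count r o).
  by case: (eqVneq r b.+1) => [->|//] /=; lia.
by case: ifP => _ /=; rewrite tableau_of_rcons.
Qed.

(** * Vacillating tableaux and walks *)

Definition half_step (w : seq nat) x :=
  (delete_word (take x.-1 w) (nth 0 w x.-1) (drop x w)).1.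

Definition full_step (w : seq nat) x :=
  insert_word (take x.-1 w) (drop x.-1 (half_step w x)).

Fixpoint word_shapes (w s : seq nat) : seq partition_shape :=
  word_shape w ::
  (if s is x :: s' then word_shape (half_step w x) ::
    word_shapes (full_step w x).1 s' else [::]).

Fixpoint bumps_first_row (w s : seq nat) : bool :=
  if s is x :: s' then (0 < (full_step w x).2)
    && bumps_first_row (full_step w x).1 s' else true.

Definition entries_upto n (s : seq nat) := all (fun x => 0 < x <= n) s.

Lemma word_stepI w1 a u u' : (delete_word w1 a u).1 = w1 ++ u' ->
  half_step (w1 ++ a :: u) (size w1).+1 = w1 ++ u' /\
  full_step (w1 ++ a :: u) (size w1).+1 = insert_word w1 u'.
Proof.
move=> Eo; have Eh : half_step (w1 ++ a :: u) (size w1).+1 = w1 ++ u'.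
  by rewrite /half_step /= take_size_cat // nth_cat ltnn subnn /= -cat_rcons drop_size_cat ?size_rcons.
by split=> //; rewrite /full_step Eh /= take_size_cat // drop_size_cat.
Qed.

Lemma word_stepP w x : 0 < x <= size w ->
  exists w1 a u u', [/\ w = w1 ++ a :: u, x = (size w1).+1 &
    [/\ (delete_word w1 a u).1 = w1 ++ u', size u' = size u,
      half_step w x = w1 ++ u' & full_step w x = insert_word w1 u']].
Proof.
move=> /andP[x0 xw]; set w1 := take x.-1 w; set a := nth 0 w x.-1; set u := drop x w.
have sz1 : size w1 = x.-1 by rewrite size_take; case: ltnP; lia.
have Ex : x = (size w1).+1 by rewrite sz1 prednK.
have Ew : w = w1 ++ a :: u.
  rewrite -{1}(cat_take_drop x.-1 w); congr (_ ++ _).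
  by rewrite (drop_nth 0) ?prednK //; lia.
have [u' Eo szu'] := delete_word_cat w1 a u.
by have [Eh Ef] := word_stepI Eo; exists w1, a, u, u'; rewrite -Eh -Ef -Ew -Ex.
Qed.

Lemma letter_count_cat i p q :
  letter_count i (p ++ q) = letter_count i p + letter_count i q.
Proof. exact: count_cat. Qed.

Lemma letter_count_size i w : letter_count i w <= size w.
Proof. exact: count_size. Qed.

Lemma half_step_ballot w x : ballot w -> 0 < x <= size w -> ballot (half_step w x).
Proof.
move=> wB /word_stepP[w1 [a [u [u' [Ew _ [Eo _ -> _]]]]]].
by rewrite -Eo; apply: delete_word_ballot; rewrite -Ew.
Qed.

Lemma full_step_ballot w x : ballot w -> 0 < x <= size w -> ballot (full_step w x).1.
Proof.
move=> wB xw; have := half_step_ballot wB xw.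
by have [w1 [a [u [u' [_ _ [_ _ -> ->]]]]]] := word_stepP xw; apply: insert_word_ballot.
Qed.

Lemma full_step_size w x : 0 < x <= size w -> size (full_step w x).1 = size w.
Proof.
move=> /word_stepP[w1 [a [u [u' [-> _ [_ szu' _ ->]]]]]].
by rewrite size_insert_word !size_cat /= szu' addnS.
Qed.

Lemma half_step_cnt w x : 0 < x <= size w ->
  exists b, forall i, letter_count i w = letter_count i (half_step w x) + (i == b).
Proof.
move=> /word_stepP[w1 [a [u [u' [-> _ [Eo _ -> _]]]]]].
by exists (delete_word w1 a u).2 => i; rewrite -Eo delete_word_count.
Qed.

Lemma full_step_cnt w x i : 0 < x <= size w ->
  letter_count i (full_step w x).1
    = letter_count i (half_step w x) + (i == (full_step w x).2).
Proof. by move=> /word_stepP[w1 [a [u [u' [_ _ [_ _ -> ->]]]]]];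
  apply: insert_word_count. Qed.

Lemma shapes_from_tableau_of w s : ballot w -> entries_upto (size w) s ->
  shapes_from (tableau_of (iota 1 (size w)) w) s = word_shapes w s.
Proof.
elim: s w => [|x s IH] w wB /=; first by rewrite shape_tableau_of ?size_iota.
move=> /andP[xw sw]; rewrite shape_tableau_of ?size_iota //; congr (_ :: _).
have fB := full_step_ballot wB xw; have fsz := full_step_size xw;
  have hB := half_step_ballot wB xw.
have [w1 [a [u [u' [Ew Ex [Eo szu' Eh Ef]]]]]] := word_stepP xw.
have Eiota : iota 1 (size w) = iota 1 (size w1) ++ x :: iota x.+1 (size u).
  by rewrite Ew size_cat /= iotaD /= add1n Ex.
have srt : sorted ltn (iota 1 (size w1) ++ x :: iota x.+1 (size u)).
  by rewrite -Eiota iota_ltn_sorted.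
have wB' := wB; rewrite Ew in wB'.
have jdtE := jdt_toE (jdt_tableau_of (size_iota _ _) (size_iota _ _) srt wB').
rewrite Eo -Eiota -Ew in jdtE; rewrite jdtE shape_tableau_of -?Eh; last first.
  by rewrite Eh !size_cat !size_iota szu'.
congr (_ :: _); rewrite Eh in hB.
have [|rskE _] := rsk_tableau_of (size_iota 1 (size w1)) _ srt hB;
  first by rewrite size_iota.
by rewrite Eh rskE -Ef -Eiota -fsz IH // fsz.
Qed.

Lemma nth_behead_shape w i : nth 0 (behead (word_shape w)) i = letter_count i.+1 w.
Proof. by rewrite nth_behead nth_word_shape. Qed.

Lemma behead_shape_part w : ballot w -> is_part (behead (word_shape w)).
Proof. by move=> wB; apply/behead_part/ballot_part. Qed.

Lemma mem_ups l i : addable l i -> incr_nth l i \in ups l.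
Proof.
move=> Ai; apply: map_f; rewrite mem_filter Ai mem_index_iota /=.
exact: addable_size.
Qed.

Lemma mem_downs l i : removable l i -> decr_nth l i \in downs l.
Proof.
move=> Ri; apply: map_f; rewrite mem_filter Ri mem_index_iota /=.
exact: removable_size.
Qed.

Lemma walksSP k l P : reflect
  (exists h m Q, [/\ h \in l :: downs l, m \in ups h, Q \in walks k m & P = l :: h ::
    Q])
  (P \in walks k.+1 l).
Proof.
apply: (iffP (@allpairsPdep _ _ _ (fun h P => l :: h :: P) _ _ _)).
  move=> [h [Q [hl /(@allpairsPdep _ _ _ (fun _ P => P))[m [Q' [mh Qm ->]]] ->]]].
  by exists h, m, Q'.
move=> [h [m [Q [hl mh Qm ->]]]]; exists h, Q; split=> //.
by apply/(@allpairsPdep _ _ _ (fun _ P => P)); exists m, Q.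
Qed.

(** The box removed from the first row, [b = 0], is invisible in the simplified shape. *)
Lemma down_step w h b : ballot w -> ballot h ->
  (forall i, letter_count i w = letter_count i h + (i == b)) ->
  behead (word_shape h) \in behead (word_shape w) :: downs (behead (word_shape w)).
Proof.
move=> wB hB E; have wP := behead_shape_part wB; have hP := behead_shape_part hB.
rewrite inE; case: b E => [|b] E; apply/orP; [left|right].
  by apply/eqP/part_eq => // i; rewrite !nth_behead_shape E addn0.
have Rb : removable (behead (word_shape w)) b.
  rewrite /removable !nth_behead_shape !E.
  by have := ballot_content hB b.+1; lia.
have -> : behead (word_shape h) = decr_nth (behead (word_shape w)) b.
  apply: part_eq => // [|i]; first exact: is_part_decr.
  by rewrite nth_decr_nth // !nth_behead_shape E eqSS addnK.
exact: mem_downs.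
Qed.

Lemma up_step w h c : ballot w -> ballot h ->
  (forall i, letter_count i w = letter_count i h + (i == c.+1)) ->
  behead (word_shape w) \in ups (behead (word_shape h)).
Proof.
move=> wB hB E; have wP := behead_shape_part wB; have hP := behead_shape_part hB.
have Ac : addable (behead (word_shape h)) c.
  rewrite /addable !nth_behead_shape; case: c E => //= c E.
  by have := ballot_content wB c.+1; rewrite !E; lia.
have -> : behead (word_shape w) = incr_nth (behead (word_shape h)) c.
  apply: part_eq => // [|i]; first exact: is_part_incr.
  by rewrite nth_incr_nth !nth_behead_shape E eqSS addnC eq_sym.
exact: mem_ups.
Qed.

(** When the first row has more than [x] boxes, some entry larger than [x] is still
there after the deletion, so the insertion bumps. Each round shortens the first row
by at most one box, which the bound on [letter_count 0 w] allows for. *)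
Lemma word_walk n w s : ballot w -> entries_upto n s ->
  n + size s <= letter_count 0 w ->
  simplified (word_shapes w s) \in walks (size s) (behead (word_shape w)).
Proof.
elim: s w => [|x s IH] w wB; first by rewrite inE.
move=> /andP[/andP[x0 xn] sn] /= nw.
have xw : 0 < x <= size w by have := letter_count_size 0 w; lia.
have hB := half_step_ballot wB xw; have fB := full_step_ballot wB xw.
have [b hE] := half_step_cnt xw.
have c0 : 0 < (full_step w x).2.
  have [w1 [a [u [u' [Ew Ex [Eo szu' Eh ->]]]]]] := word_stepP xw;
    apply: insert_word_below.
  rewrite -has_pred1 has_count -/(letter_count 0 u'); have := hE 0.
  by rewrite Eh letter_count_cat; have := letter_count_size 0 w1; lia.
have fE := fun i => full_step_cnt i xw; case: (full_step w x).2 c0 fE => // c _ fE.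
apply/walksSP; exists (behead (word_shape (half_step w x))), (behead (word_shape (full_step w x).1)).
exists (simplified (word_shapes (full_step w x).1 s)); split=> //.
- exact: down_step hE.
- exact: up_step fE.
by apply: IH => //; rewrite fE hE in nw *; lia.
Qed.

Lemma behead_shape_rcons0 w : behead (word_shape (rcons w 0)) = behead (word_shape w).
Proof. by rewrite word_shape_rcons; case: (word_shape w). Qed.

Lemma step_rcons0 w x : 0 < x <= size w ->
  half_step (rcons w 0) x = rcons (half_step w x) 0 /\
  full_step (rcons w 0) x = insert_step (full_step w x) 0.
Proof.
move=> /word_stepP[w1 [a [u [u' [-> -> [Eo _ -> ->]]]]]].
rewrite -insert_word_rcons rcons_cat rcons_cons rcons_cat; apply: word_stepI.
by rewrite delete_word_rcons /delete_step /= Eo rcons_cat.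
Qed.

(** A zero at the end of the word is not affected by a deletion, nor by an insertion
whose box has already left the first row. *)
Lemma simplified_rcons0 w s : entries_upto (size w) s -> bumps_first_row w s ->
  bumps_first_row (rcons w 0) s /\
  simplified (word_shapes (rcons w 0) s) = simplified (word_shapes w s).
Proof.
elim: s w => [|x s IH] w /=; first by rewrite behead_shape_rcons0.
move=> /andP[xw sw] /andP[c0 st].
have [-> ->] := step_rcons0 xw.
have c0' : 0 == (full_step w x).2 = false by rewrite ltn_eqF.
rewrite /insert_step c0' !addn0 /= c0 !behead_shape_rcons0.
by have [|-> ->] := IH _ _ st; rewrite ?full_step_size.
Qed.

Lemma sumn_word_shape w : sumn (word_shape w) = size w.
Proof.
elim/last_ind: w => // w r IH.
by rewrite word_shape_rcons sumn_incr_nth IH size_rcons.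
Qed.

Lemma sumn_behead_shape w : letter_count 0 w + sumn (behead (word_shape w)) = size w.
Proof.
by rewrite -sumn_word_shape -nth_word_shape; case: (word_shape w).
Qed.

(** Fill the rows of the partition one after the other. *)
Lemma part_word l : is_part l -> exists2 w, ballot w & word_shape w = l.
Proof.
have [n] := ubnP (sumn l); elim: n l => // n IH l; rewrite ltnS => ln lP.
case: (eqVneq l [::]) => [->|l0]; first by exists [::]; [exact: ballot_nil|].
have Rl : removable l (size l).-1.
  have sz : 0 < size l by rewrite lt0n size_eq0.
  rewrite /removable prednK // nth_default // lt0n.
  by apply: contra lP.1 => /eqP <-; rewrite mem_nth ?prednK.
have [Al El] := incr_decr lP Rl; have dP := is_part_decr lP Rl.
have [|//|w wB Ew] := IH (decr_nth l (size l).-1).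
  by rewrite -El sumn_incr_nth in ln.
exists (rcons w (size l).-1); last by rewrite word_shape_rcons Ew.
apply: ballot_rcons => // i; rewrite -!nth_word_shape word_shape_rcons Ew El.
exact: lP.2.
Qed.

Lemma nth_le_sumn l i : nth 0 l i <= sumn l.
Proof.
elim: l i => [|n l IH] [|i] /=; rewrite ?leq_addr //.
by apply: leq_trans (IH i) (leq_addl _ _).
Qed.

(** Induction from the end of the walk: a word for the rest of the walk is scanned
backwards, first for the insertion and then for the deletion. The bound on [N]
makes the first row longer than the second one throughout, so that a box removed
from the second row can be put back, and [(N - sumn l) :: l] is a partition. *)
Lemma walk_word k l P N : is_part l -> P \in walks k l -> 2 * (sumn l + k) < N ->
  exists w s, [/\ size w = N, ballot w, behead (word_shape w) = l &
    [/\ size s = k, entries_upto N s, bumps_first_row w s &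
      simplified (word_shapes w s) = P]].
Proof.
elim: k l P => [|k IH] l P lP.
  rewrite inE => /eqP -> lN.
  have lP' : is_part (N - sumn l :: l).
    split; first by rewrite inE negb_or lP.1 andbT; lia.
    by case=> [|i]; [have := nth_le_sumn l 0 => /=; lia|exact: lP.2].
  have [w wB Ew] := part_word lP'.
  exists w, [::]; rewrite -sumn_word_shape /= Ew; split=> //=; lia.
move=> /walksSP[h [m [Q [hl mh Qm ->]]]] lN.
have hP : is_part h by move: hl; rewrite inE => /predU1P[-> //|]; apply: in_downs_part.
have sz_h : sumn h <= sumn l.
  move: hl; rewrite inE => /predU1P[-> //|/mapP[i]].
  rewrite mem_filter => /andP[Ri _] ->.
  by have [_ E] := incr_decr lP Ri; rewrite -{2}E sumn_incr_nth.
have mP := in_ups_part hP mh.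
move: mh => /mapP[c]; rewrite mem_filter => /andP[Ac _] Em.
have [|w' [s [szw' w'B Ew' [szs sN st EQ]]]] := IH m Q mP Qm.
  by rewrite Em sumn_incr_nth; lia.
have w'E i : letter_count i.+1 w' = (c == i) + nth 0 h i.
  by rewrite -nth_behead_shape Ew' Em nth_incr_nth.
have [|w1 [u' [Ei wuB]]] := @insert_word_inv w' c.+1 w'B.
  have [+ _] := decr_incr hP Ac; rewrite /removable !nth_incr_nth !w'E; lia.
have wuE i : letter_count i.+1 (w1 ++ u') = nth 0 h i.
  have := insert_word_count w1 u' i.+1; rewrite Ei w'E eqSS eq_sym /=; lia.
have szwu : size (w1 ++ u') = N.-1 by have := size_insert_word w1 u'; rewrite Ei szw';
  lia.
have shE : behead (word_shape (w1 ++ u')) = h.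
  by apply: part_eq => // [|i]; [exact: behead_shape_part|rewrite nth_behead_shape].
(* If the walk stays, the deletion takes its box from the first row: [b = 0]. *)
have [b bC lE] : exists2 b, lattice_content (rcons (w1 ++ u') b) &
    forall i, nth 0 l i = nth 0 h i + (i.+1 == b).
  move: hl; rewrite inE => /predU1P[<-|/mapP[i]].
    exists 0 => i; last by rewrite addn0.
    by rewrite !letter_count_rcons; have := ballot_content wuB i; lia.
  rewrite mem_filter => /andP[Ri _] Eh; have [Ai El] := incr_decr lP Ri.
  exists i.+1 => j; last by rewrite -[in LHS]El nth_incr_nth -Eh eqSS addnC eq_sym.
  have := ballot_content wuB j; rewrite !letter_count_rcons eqSS.
  case: (eqVneq j i) => [->|]; last by lia.
  rewrite wuE; case: i Ri Ai Eh {El} => [|i] Ri Ai Eh _.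
    have := sumn_behead_shape (w1 ++ u'); rewrite shE szwu.
    by have := nth_le_sumn h 0; lia.
  by move: Ai; rewrite -Eh /addable /= wuE; lia.
have [a [u [Ed szu wauB]]] := delete_word_inv wuB bC.
have Eo : (delete_word w1 a u).1 = w1 ++ u' by rewrite Ed.
have [Eh Ef] := word_stepI Eo.
have szw : size (w1 ++ a :: u) = N by rewrite size_cat /= szu addnS -size_cat szwu; lia.
have Esh : behead (word_shape (w1 ++ a :: u)) = l.
  apply: part_eq => // [|i]; first exact: behead_shape_part.
  by rewrite nth_behead_shape delete_word_count Ed /= wuE lE.
exists (w1 ++ a :: u), ((size w1).+1 :: s); split=> //; split.
- by rewrite /= szs.
- by rewrite /= sN andbT -szw size_cat /=; lia.
- by rewrite /= Ef Ei /= st.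
by rewrite /= Ef Eh Ei Esh shE EQ.
Qed.

Lemma nseq_rcons0 N : nseq N.+1 0 = rcons (nseq N 0) 0.
Proof. by elim: N => //= N <-. Qed.

Lemma ballot_nseq0 N : ballot (nseq N 0).
Proof.
elim: N => [|N IH]; first exact: ballot_nil.
rewrite nseq_rcons0; apply: ballot_rcons => // i; rewrite !letter_count_rcons.
by have := ballot_content IH i; lia.
Qed.

Lemma behead_shape_nseq0 N : behead (word_shape (nseq N 0)) = [::].
Proof. by elim: N => // N IH; rewrite nseq_rcons0 behead_shape_rcons0. Qed.

(** The backward construction thus ends at the initial tableau, with a single row. *)
Lemma behead_shape_nil w : behead (word_shape w) = [::] -> w = nseq (size w) 0.
Proof.
move=> E; apply/all_pred1P/allP => -[|y] //= yw.
by have := nth_behead_shape w y; rewrite E nth_nil /letter_count; move: yw;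
  rewrite -has_pred1 has_count; lia.
Qed.

Lemma vacillating_word m s : 0 < m -> entries_upto m s ->
  vacillating_tableau m s = word_shapes (nseq m 0) s.
Proof.
move=> m0 sm; rewrite -shapes_from_tableau_of ?size_nseq //; last exact: ballot_nseq0.
rewrite /vacillating_tableau; congr (shapes_from _ _).
case: m m0 {sm} => // m _; elim: m => // m IH.
have -> : iota 1 m.+2 = rcons (iota 1 m.+1) m.+2.
  by rewrite -[m.+2 in LHS]addn1 iotaD cats1 add1n.
by rewrite nseq_rcons0 tableau_of_rcons ?size_iota ?size_nseq // -IH.
Qed.

Lemma simplified_nseq0 N d s : entries_upto N s -> bumps_first_row (nseq N 0) s ->
  bumps_first_row (nseq (d + N) 0) s /\
  simplified (word_shapes (nseq (d + N) 0) s) = simplified (word_shapes (nseq N 0) s).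
Proof.
move=> sN st; elim: d => //= d [IHs <-];
  rewrite -[0 :: _]/(nseq (d + N).+1 0) nseq_rcons0.
apply: simplified_rcons0 => //; apply: sub_all sN => x; rewrite size_nseq; lia.
Qed.

Lemma entries_upto_max s : all (fun x => 0 < x) s -> 
  exists n, entries_upto n s /\ all (fun x => x <= n) s.
Proof.
move=> s0; exists (sumn s).
have sle : all (fun x => x <= sumn s) s.
  by apply/(all_nthP 0) => i _; apply: nth_le_sumn.
split=> //; apply/allP => x xs.
by rewrite (allP s0 _ xs) (allP sle _ xs).
Qed.

Lemma limiting_vt_walk k s P : size s = k -> all (fun x => 0 < x) s ->
  is_limiting_vt s P -> P \in walks k [::].
Proof.
move=> szs s0 sP; have [n [sn sle]] := entries_upto_max s0.
pose m := (n + 2 * size s).+1.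
have sm : entries_upto m s by apply: sub_all sn => x; rewrite /m; lia.
rewrite -(sP n m sle) // vacillating_word // -szs -(behead_shape_nseq0 m).
apply: (word_walk _ sn); first exact: ballot_nseq0.
by rewrite /letter_count count_nseq /m /=; lia.
Qed.

(** Since [k > 0] and the entries are positive, [n > 0], and the condition
[n + 2 * k < m] already implies [2 * k + 1 <= m]. *)
Lemma walk_limiting_vt k P : 0 < k -> P \in walks k [::] ->
  exists s, [/\ size s = k, all (fun x => 0 < x) s & is_limiting_vt s P].
Proof.
move=> k0 Pk.
have [||w [s [szw wB Ew [szs sN st EP]]]] := @walk_word k [::] P (2 * k).+1 _ Pk.
- by split=> // i; rewrite !nth_nil.
- by rewrite /=.
exists s; split=> //; first by apply: sub_all sN => x /andP[].
move=> n m sn; rewrite szs => nm.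
have n0 : 0 < n.
  case: s szs sN sn {st EP} => [|x s]; first by move=> E; rewrite -E in k0.
  by move=> _ /= /andP[/andP[x0 _] _] /andP[xn _]; apply: leq_trans xn.
have sm : entries_upto m s by apply: sub_all sN => x; lia.
rewrite vacillating_word //; last by lia.
move: st EP; rewrite (behead_shape_nil Ew) szw => st <-.
have -> : m = m - (2 * k).+1 + (2 * k).+1 by lia.
by case: (simplified_nseq0 (m - (2 * k).+1) sN st).
Qed.

(** * Counting limiting vacillating tableaux *)

From mathcomp Require Import mathcomp_extra boolp classical_sets cardinality.

Lemma limiting_vtsE k : 0 < k ->
  limiting_vts k = [set` [fset P | P in walks k [::]]%fset]%classic.
Proof.
move=> k0; apply/seteqP; split=> P /=; rewrite in_fset /=.
  by move=> [s [szs s0 sP]]; apply: limiting_vt_walk sP.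
exact: walk_limiting_vt.
Qed.

Lemma limiting_vt_countE k : limiting_vt_count k = size (walks k [::]).
Proof.
case: k => // k; rewrite /limiting_vt_count limiting_vtsE // set_fsetK card_fseq.
by rewrite undup_id // uniq_walks //; split=> // i; rewrite !nth_nil.
Qed.

Theorem theorem10 :
  (forall k : nat, 0 < k ->
     \sum_(1 <= j < k.+1) stirling2 k j * involutions j
     = \sum_(1 <= t < k.+1) stirling2 k t * 2 ^ (k - t))
  /\
  ((forall k : nat, 0 < k -> finite_set (limiting_vts k)) /\
   (forall k : nat, limiting_vt_count k = A004211 k)).
Proof.
split=> [k k0|]; last split=> [k k0|[|k]] //.
- rewrite !sum_stirling2_from1 //; under eq_bigr => j _ do rewrite involutionsE.
  exact: doubling_recurrence_uniq stirling_involution_doubling stirling_pow2_doubling k.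
- by rewrite limiting_vtsE //; apply: finite_fset.
rewrite limiting_vt_countE /A004211.
under eq_bigr => t _ do rewrite mulnC.
rewrite (sum_stirling2_from1 (fun t => 2 ^ (k.+1 - t))) //.
exact: doubling_recurrence_uniq size_walks_doubling stirling_pow2_doubling k.+1.
Qed.
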